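(* The Fourier-PIC scheme described in the context preserves the discrete Gauss laws $$\operatorname{div}\boldsymbol E_K=\Pi^3\rho^S_N=\sum_{p=1}^Nq_p\,\Pi^3S_{\boldsymbol X_p},\qquad\operatorname{div}\boldsymbol B_K=0,$$ and the discrete momentum $$\mathcal P=\sum_{p=1}^Nm_p\boldsymbol V_p+\int_{[0,L]^3}\boldsymbol E_K(\boldsymbol x)\times\boldsymbol B_K(\boldsymbol x)\,d\boldsymbol x .$$
   Context: Let $L>0$, $K\ge0$, $M\ge2K+1$, $N\ge1$ be given ($K,M,N$ integers), with particle charges $q_p$ and masses $m_p$, $1\le p\le N$; set $h=L/M$. Dimension indices are circular: $\alpha\equiv\alpha+3$. Let $\gamma_{\boldsymbol k}=\overline{\gamma_{-\boldsymbol k}}\in\mathbb C$ be Hermitian filter coefficients and $\Lambda_{\boldsymbol k}(\boldsymbol x)=e^{2i\pi\boldsymbol k\cdot\boldsymbol x/L}$. All sums over $\boldsymbol k$ are over $\{-K,\dots,K\}^3$. Shape function. $S$ is a real-valued continuous shape function, $L$-periodic in each of the three variables; $S_{\boldsymbol y}(\boldsymbol x)=S(\boldsymbol x-\boldsymbol y)$, and $\rho^S_N=\sum_{p=1}^Nq_pS_{\boldsymbol X_p}$. Coupling operators. $\tilde{\mathcal F}_{M,\boldsymbol k}=\tilde{\mathcal F}_{M,k_1}\otimes\tilde{\mathcal F}_{M,k_2}\otimes\tilde{\mathcal F}_{M,k_3}$ is the functional on continuous periodic functions obtained by applying in each variable the univariate functional $$\tilde{\mathcal F}_{M,k_\alpha}(g)=\begin{cases}\frac1L\int_0^Lg(x)\,dx&\text{if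 }k_\alpha=0,\\ \frac1M\sum_{m=1}^Mg(mh)\,e^{-2i\pi k_\alpha m/M}&\text{if }k_\alpha\ne0,\end{cases}$$ and $\Pi^3G=\sum_{\boldsymbol k}(\Pi^3G)_{\boldsymbol k}\Lambda_{\boldsymbol k}$ with $(\Pi^3G)_{\boldsymbol k}=\gamma_{\boldsymbol k}\tilde{\mathcal F}_{M,\boldsymbol k}(G)$. Moreover $(\Pi^2_\alpha G)_{\boldsymbol k}=\gamma_{\boldsymbol k}\tilde{\mathcal F}_{M,\boldsymbol k}(G)$ if $k_\alpha=0$ and $(\Pi^2_\alpha G)_{\boldsymbol k}=\gamma_{\boldsymbol k}\big(\frac{2i\pi k_\alpha}L\big)^{-1}\tilde{\mathcal F}_{M,\boldsymbol k}(\partial_\alpha G)$ if $k_\alpha\ne0$. State: particle positions $\boldsymbol X_p=(X_{p,\alpha})_\alpha\in\mathbb R^3$, velocities $\boldsymbol V_p=(V_{p,\alpha})_\alpha\in\mathbb R^3$, and real-valued fields $\boldsymbol E_K=\sum_{\boldsymbol k}\boldsymbol E_{\boldsymbol k}\Lambda_{\boldsymbol k}$, $\boldsymbol B_K=\sum_{\boldsymbol k}\boldsymbol B_{\boldsymbol k}\Lambda_{\boldsymbol k}$ with coefficients $\boldsymbol E_{\boldsymbol k}=(E_{\alpha,\boldsymbol k})_\alpha$, $\boldsymbol B_{\boldsymbol k}=(B_{\alpha,\boldsymbol k})_\alpha$ in $\mathbb C^3$. The Fourier-PIC scheme. A time step is a composition (Lie–Trotter, Strang, or higher order) of the following split flows,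 a superscript $0$ denoting the initial value of a split step. Kinetic flow $\varphi_{\tau,v_\alpha}$, $\alpha\in\{1,2,3\}$: for all $p$, $\boldsymbol k$ and $\nu=\pm1$, $$\begin{aligned} &X_{p,\alpha}(\tau)=X^0_{p,\alpha}+\tau V_{p,\alpha},\quad X_{p,\alpha+\nu}(\tau)=X^0_{p,\alpha+\nu},\quad V_{p,\alpha}(\tau)=V^0_{p,\alpha},\\ &V_{p,\alpha+\nu}(\tau)=V^0_{p,\alpha+\nu}-\nu\tau\frac{q_p}{m_p}L^3\sum_{\boldsymbol k}B_{\alpha-\nu,\boldsymbol k}\,\overline{\hat V^3_{p,\alpha,\boldsymbol k}(\tau)},\\ &E_{\alpha,\boldsymbol k}(\tau)=E^0_{\alpha,\boldsymbol k}-\tau\sum_pq_p\hat V^3_{p,\alpha,\boldsymbol k}(\tau),\quad E_{\alpha+\nu,\boldsymbol k}(\tau)=E^0_{\alpha+\nu,\boldsymbol k},\quad \boldsymbol B_K(\tau)=\boldsymbol B_K^0, \end{aligned}$$ where $$\hat V^3_{p,\alpha,\boldsymbol k}(\tau)=\begin{cases}V_{p,\alpha}(\Pi^3S_{\boldsymbol X_p^0})_{\boldsymbol k}&\text{if }k_\alpha=0,\\-\big(\frac{2i\pi k_\alpha}L\big)^{-1}\frac1\tau\big((\Pi^3S_{\boldsymbol X_p(\tau)})_{\boldsymbol k}-(\Pi^3S_{\boldsymbol X_p^0})_{\boldsymbol k}\big)&\text{if }k_\alpha\ne0.\end{cases}$$ This is the explicit solution of the kinetic subsystem $$\tfrac d{dt}X_{p,\alpha}=V_{p,\alpha},\quad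 \tfrac d{dt}V_{p,\alpha+\nu}=-\nu\tfrac{q_p}{m_p}L^3\sum_{\boldsymbol k}V_{p,\alpha}B_{\alpha-\nu,\boldsymbol k}\overline{(\Pi^2_\alpha S_{\boldsymbol X_p})_{\boldsymbol k}},\quad \tfrac d{dt}E_{\alpha,\boldsymbol k}=-\sum_pq_pV_{p,\alpha}(\Pi^2_\alpha S_{\boldsymbol X_p})_{\boldsymbol k},$$ all other unknowns ($X_{p,\alpha+\nu}$, $V_{p,\alpha}$, $E_{\alpha+\nu,\boldsymbol k}$, $\boldsymbol B_{\boldsymbol k}$) being constant. Electromagnetic flow $\varphi_{\tau,EB}$: the exact time-$\tau$ solution of $$\tfrac d{dt}\boldsymbol X_p=0,\quad\tfrac d{dt}\boldsymbol V_p=\frac{q_p}{m_p}L^3\sum_{\boldsymbol k}\boldsymbol E_{\boldsymbol k}\overline{(\Pi^3S_{\boldsymbol X_p})_{\boldsymbol k}},\quad\tfrac d{dt}\boldsymbol E_{\boldsymbol k}=\tfrac{2i\pi\boldsymbol k}L\times\boldsymbol B_{\boldsymbol k},\quad\tfrac d{dt}\boldsymbol B_{\boldsymbol k}=-\tfrac{2i\pi\boldsymbol k}L\times\boldsymbol E_{\boldsymbol k}.$$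
   Formalization: Conservation of the discrete momentum is stated for initial data that satisfy both discrete Gauss laws; without them it fails (e.g. K=0, one charged particle in a constant nonzero electric field). *)

(* Defs.v *)
From HB Require Import structures.
From mathcomp Require Import all_boot all_order all_algebra.
From mathcomp Require Import all_classical all_reals all_analysis.
From mathcomp Require Import complex.

Set Implicit Arguments.
Unset Strict Implicit.
Unset Printing Implicit Defensive.

Import Order.TTheory GRing.Theory Num.Theory.
Import numFieldNormedType.Exports.

Local Open Scope classical_set_scope.
Local Open Scope complex_scope.
Local Open Scope ring_scope.

(* Dimension indices live in 'I_3, whose ring structure is that of Z/3Z, so
   that alpha + 1 and alpha - 1 are the circular successor and predecessor. *)

Definition vec3 (T : pzRingType) (a b c : T) : 'rV[T]_3 :=
  \row_(i < 3) [:: a; b; c]`_i.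

Definition cross (T : pzRingType) (u v : 'rV[T]_3) : 'rV[T]_3 :=
  \row_(i < 3) (u 0 (i + 1) * v 0 (i - 1) - u 0 (i - 1) * v 0 (i + 1)).

Section ComplexAnalysis.
Variable R : realType.

Definition expi (t : R) : R[i] := cos t +i* sin t.

Definition Cintegral d (T : measurableType d) (mu : {measure set T -> \bar R})
    (D : set T) (f : T -> R[i]) : R[i] :=
  (\int[mu]_(x in D) complex.Re (f x)) +i* (\int[mu]_(x in D) complex.Im (f x)).

Definition is_Cderive (f : R -> R[i]) (t : R) (d : R[i]) : Prop :=
  is_derive t 1 (fun s => complex.Re (f s)) (complex.Re d) /\
  is_derive t 1 (fun s => complex.Im (f s)) (complex.Im d).

Definition partial (a : 'I_3) (f : 'rV[R]_3 -> R[i]) (x : 'rV[R]_3) : R[i] :=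
  ('D_(delta_mx 0 a) (fun y => complex.Re (f y)) x)
  +i* ('D_(delta_mx 0 a) (fun y => complex.Im (f y)) x).

Definition divergence (F : 'rV[R]_3 -> 'rV[R[i]]_3) (x : 'rV[R]_3) : R[i] :=
  \sum_(a < 3) partial a (fun y => F y 0 a) x.

Definition lebesgue3 :
  {measure set (measurableTypeR R * measurableTypeR R * measurableTypeR R)%type
     -> \bar R} :=
  ((@lebesgue_measure R \x @lebesgue_measure R) \x @lebesgue_measure R)%E.

Definition integral_cube (L : R) (F : 'rV[R]_3 -> 'rV[R[i]]_3) : 'rV[R[i]]_3 :=
  \row_(a < 3) Cintegral lebesgue3 (`[0, L] `*` `[0, L] `*` `[0, L])
    (fun x => F (vec3 x.1.1 x.1.2 x.2) 0 a).

End ComplexAnalysis.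

(* The Fourier modes {-K, ..., K}^3 are encoded by shifting each component
   by K. *)
Notation mode K := {ffun 'I_3 -> 'I_(K.*2.+1)}.

Definition kval (K : nat) (k : mode K) (a : 'I_3) : int := (k a)%:Z - K%:Z.

Definition oppmode (K : nat) (k : mode K) : mode K :=
  [ffun a => rev_ord (k a)].

Lemma kval_oppmode K (k : mode K) a : kval (oppmode k) a = - kval k a.
Proof.
rewrite /kval ffunE /= subSS; have := ltn_ord (k a).
move: (nat_of_ord (k a)) => j; rewrite ltnS => jK.
by rewrite -subzn // -addnn PoszD opprB addrAC addrK.
Qed.

Record state (R : realType) (K N : nat) := State {
  pos : 'I_N -> 'rV[R]_3;
  vel : 'I_N -> 'rV[R]_3;
  Ecoef : mode K -> 'rV[R[i]]_3;
  Bcoef : mode K -> 'rV[R[i]]_3 }.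

Inductive split_flow := Kinetic of 'I_3 | Electromagnetic.

Section FourierPIC.
Variables (R : realType) (K M N : nat) (L : R).
Variables (q m : 'I_N -> R) (gamma : mode K -> R[i]) (S : 'rV[R]_3 -> R).

Definition ik (k : mode K) : 'rV[R[i]]_3 :=
  \row_(a < 3) ((2 * pi * (kval k a)%:~R / L) *i).

Definition Lambda (k : mode K) (x : 'rV[R]_3) : R[i] :=
  expi (2 * pi * (\sum_(a < 3) (kval k a)%:~R * x 0 a) / L).

Definition trig_field (c : mode K -> 'rV[R[i]]_3) (x : 'rV[R]_3) :
    'rV[R[i]]_3 :=
  \sum_(k : mode K) Lambda k x *: c k.

Definition EK (s : state R K N) := trig_field (Ecoef s).
Definition BK (s : state R K N) := trig_field (Bcoef s).

Definition real_valued (F : 'rV[R]_3 -> 'rV[R[i]]_3) : Prop :=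
  forall x a, complex.Im (F x 0 a) = 0.

Definition F1 (k : int) (g : R -> R[i]) : R[i] :=
  if k == 0 then (L^-1)%:C * Cintegral (@lebesgue_measure R) `[0, L] g
  else M%:R^-1 * \sum_(1 <= j < M.+1)
         g (j%:R * (L / M%:R)) * expi (- (2 * pi * k%:~R * j%:R / M%:R)).

Definition F3 (k : mode K) (G : 'rV[R]_3 -> R[i]) : R[i] :=
  F1 (kval k 0) (fun x1 =>
    F1 (kval k 1) (fun x2 =>
      F1 (kval k 2) (fun x3 => G (vec3 x1 x2 x3)))).

Definition Pi3coef (G : 'rV[R]_3 -> R[i]) (k : mode K) : R[i] :=
  gamma k * F3 k G.

Definition Pi3 (G : 'rV[R]_3 -> R[i]) (x : 'rV[R]_3) : R[i] :=
  \sum_(k : mode K) Pi3coef G k * Lambda k x.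

Definition shape_at (y x : 'rV[R]_3) : R[i] := (S (x - y))%:C.

Definition rho (s : state R K N) (x : 'rV[R]_3) : R[i] :=
  \sum_(p < N) (q p)%:C * shape_at (pos s p) x.

Definition Vhat3 (tau : R) (s s' : state R K N) (p : 'I_N) (a : 'I_3)
    (k : mode K) : R[i] :=
  if kval k a == 0 then (vel s p 0 a)%:C * Pi3coef (shape_at (pos s p)) k
  else - (ik k 0 a)^-1 * (tau^-1)%:C *
       (Pi3coef (shape_at (pos s' p)) k - Pi3coef (shape_at (pos s p)) k).

(* At tau = 0 this is the identity, since 0^-1 = 0. *)
Definition kinetic_flow (a : 'I_3) (tau : R) (s s' : state R K N) : Prop :=
  [/\ (forall p, pos s' p 0 a = pos s p 0 a + tau * vel s p 0 a) /\
      (forall p, vel s' p 0 a = vel s p 0 a),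
      forall (nu : int), nu = 1 \/ nu = -1 ->
        [/\ forall p, pos s' p 0 (a + nu%:~R) = pos s p 0 (a + nu%:~R),
            forall p, (vel s' p 0 (a + nu%:~R))%:C =
              (vel s p 0 (a + nu%:~R))%:C
              - nu%:~R * tau%:C * (q p / m p)%:C * (L ^+ 3)%:C *
                \sum_(k : mode K)
                  Bcoef s k 0 (a - nu%:~R) * (Vhat3 tau s s' p a k)^*
          & forall k, Ecoef s' k 0 (a + nu%:~R) = Ecoef s k 0 (a + nu%:~R)],
      forall k, Ecoef s' k 0 a =
        Ecoef s k 0 a
        - tau%:C * \sum_(p < N) (q p)%:C * Vhat3 tau s s' p a k
    & forall k, Bcoef s' k = Bcoef s k].

(* The velocities are real; their equation is written in R[i] because its
   right-hand side is a priori complex. *)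
Definition em_solution (y : R -> state R K N) : Prop :=
  forall t : R,
  [/\ forall p b, is_derive t 1 (fun u => pos (y u) p 0 b) 0,
      forall p b, is_Cderive (fun u => (vel (y u) p 0 b)%:C) t
        ((q p / m p)%:C * (L ^+ 3)%:C * \sum_(k : mode K)
           Ecoef (y t) k 0 b * (Pi3coef (shape_at (pos (y t) p)) k)^*),
      forall k b, is_Cderive (fun u => Ecoef (y u) k 0 b) t
        (cross (ik k) (Bcoef (y t) k) 0 b)
    & forall k b, is_Cderive (fun u => Bcoef (y u) k 0 b) t
        (- cross (ik k) (Ecoef (y t) k) 0 b)].

Definition em_flow (tau : R) (s s' : state R K N) : Prop :=
  exists y : R -> state R K N, [/\ em_solution y, y 0 = s & y tau = s'].

Definition flow (f : split_flow) : R -> state R K N -> state R K N -> Prop :=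
  match f with
  | Kinetic a => kinetic_flow a
  | Electromagnetic => em_flow
  end.

(* A splitting method is the list of its split flows with their (possibly
   negative) substep durations, in order of application. *)
Fixpoint time_step (w : seq (split_flow * R)) (s s' : state R K N) : Prop :=
  match w with
  | [::] => s' = s
  | f :: w' => exists s1, flow f.1 f.2 s s1 /\ time_step w' s1 s'
  end.

Definition gaussE (s : state R K N) : Prop :=
  forall x, divergence (EK s) x = Pi3 (rho s) x.

Definition gaussB (s : state R K N) : Prop :=
  forall x, divergence (BK s) x = 0.

Definition momentum (s : state R K N) : 'rV[R[i]]_3 :=
  \sum_(p < N) (m p)%:C *: map_mx (real_complex R) (vel s p)
  + integral_cube L (fun x => cross (EK s x) (BK s x)).

End FourierPIC.

(* Main.v *)
(** Everything reduces to identities between Fourier coefficients: by orthogonality of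
the modes on the cube, the Gauss laws say i k . E_k = sum_p q_p (Pi^3 S_{X_p})_k and
i k . B_k = 0 for every k, and the field momentum is L^3 sum_k E_k x B_{-k}.

Kinetic flow: for k_a <> 0, multiplying the update of E_a by i k_a telescopes into the
change of the charge; for k_a = 0 the charge does not change, because the functional in
the variable x_a is the mean over a period, which is invariant under translation (this
is why it is not the discrete sum). Momentum is exchanged exactly since
conj (Vhat_k) = Vhat_{-k}.

Electromagnetic flow: i k . (i k x B_k) = 0 gives the Gauss laws. In the derivative of
sum_k E_k x B_{-k}, the double cross product formula produces terms i k (E_k . E_{-k})
and i k (B_k . B_{-k}), odd in k and hence of zero sum, a term in i k . B_k, which
vanishes, and a term in i k . E_k, which by the Gauss law is opposite to the force on
the particles. *)

Require Import Defs.
From HB Require Import structures.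
From mathcomp Require Import all_boot all_order all_algebra.
From mathcomp Require Import all_classical all_reals all_analysis.
From mathcomp Require Import complex.
From mathcomp Require Import ring.
Import Order.TTheory GRing.Theory Num.Theory.
Import numFieldNormedType.Exports.
Local Open Scope classical_set_scope.
Local Open Scope complex_scope.
Local Open Scope ring_scope.
Set Implicit Arguments.
Unset Strict Implicit.
Unset Printing Implicit Defensive.

(** * Real and complex parts, integrals of continuous functions *)

Section ComplexParts.
Variable R : realType.
Implicit Types (x y : R[i]) (a : R).

Lemma ReD x y : complex.Re (x + y) = complex.Re x + complex.Re y.
Proof. by case: x; case: y. Qed.

Lemma ImD x y : complex.Im (x + y) = complex.Im x + complex.Im y.
Proof. by case: x; case: y. Qed.

Lemma ReM x y : complex.Re (x * y) =
  complex.Re x * complex.Re y - complex.Im x * complex.Im y.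
Proof. by case: x; case: y. Qed.

Lemma ImM x y : complex.Im (x * y) =
  complex.Re x * complex.Im y + complex.Im x * complex.Re y.
Proof. by case: x; case: y. Qed.

Lemma Re_sum (I : Type) (r : seq I) (f : I -> R[i]) :
  complex.Re (\sum_(i <- r) f i) = \sum_(i <- r) complex.Re (f i).
Proof. exact: (big_morph _ ReD). Qed.

Lemma Im_sum (I : Type) (r : seq I) (f : I -> R[i]) :
  complex.Im (\sum_(i <- r) f i) = \sum_(i <- r) complex.Im (f i).
Proof. exact: (big_morph _ ImD). Qed.

Lemma complex_eqP x y :
  complex.Re x = complex.Re y -> complex.Im x = complex.Im y -> x = y.
Proof. by case: x => a b; case: y => c d /= -> ->. Qed.

Lemma Re_conj x : complex.Re (x^*)%R = complex.Re x.
Proof. by case: x. Qed.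

Lemma Im_conj x : complex.Im (x^*)%R = - complex.Im x.
Proof. by case: x. Qed.

Lemma conj_real a : ((a%:C)^*)%R = a%:C :> R[i].
Proof. by apply: complex_eqP; rewrite ?Re_conj ?Im_conj //= oppr0. Qed.

Lemma expiD (a b : R) : expi (a + b) = expi a * expi b.
Proof.
by apply: complex_eqP; rewrite ?ReM ?ImM /= ?cosD // sinD addrC.
Qed.

Lemma conj_expi (a : R) : ((expi a)^*)%R = expi (- a).
Proof. by apply: complex_eqP; rewrite ?Re_conj ?Im_conj /= ?cosN ?sinN. Qed.

End ComplexParts.

(** * Integrals of continuous functions: sums, parameters, periodic translation *)

Section ParameterIntegral.
Variables (R : realType).
Local Notation mu := (@lebesgue_measure R).

Lemma continuous_integrable (f : R -> R) (a b : R) :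
  continuous f -> mu.-integrable `[a, b] (EFin \o f).
Proof.
move=> cf; apply: continuous_compact_integrable; first exact: segment_compact.
exact: continuous_subspaceT.
Qed.

Lemma Rintegral_sum d (T : measurableType d) (nu : {measure set T -> \bar R})
    (D : set T) (I : Type) (r : seq I) (f : I -> T -> R) :
  measurable D -> (forall i, nu.-integrable D (EFin \o f i)) ->
  \int[nu]_(x in D) (\sum_(i <- r) f i x) = \sum_(i <- r) \int[nu]_(x in D) f i x.
Proof.
move=> mD fint.
(* Integrability of the partial sums is carried through the induction, because splitting off one
   term requires it. *)
suff : nu.-integrable D (EFin \o (fun x => \sum_(i <- r) f i x)) /\
  \int[nu]_(x in D) (\sum_(i <- r) f i x) = \sum_(i <- r) \int[nu]_(x in D) f i x.
  by case.
elim: r => [|i r [IH1 IH2]].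
  rewrite big_nil; split.
    rewrite [X in _.-integrable _ X](_ : _ = cst 0%E); first exact: integrable0.
    by apply/funext => x /=; rewrite big_nil.
  under eq_Rintegral do rewrite big_nil.
  by rewrite Rintegral_cst// mul0r.
split.
  rewrite [X in _.-integrable _ X](_ : _ = (EFin \o f i) \+
     (EFin \o (fun x => \sum_(i <- r) f i x)%R))%E.
    exact: integrableD.
  by apply/funext => x /=; rewrite big_cons.
under eq_Rintegral do rewrite big_cons.
by rewrite RintegralD// IH2 big_cons.
Qed.

(** Compactness of [[a, b]] makes [h t] uniformly close to [h t0] on the interval for [t] near [t0],
    and a uniform bound passes to the integral. The parameter space is arbitrary so that several
    free variables can be treated as one. *)
Lemma continuous_parameter_integral (T : topologicalType) (h : T -> R -> R)
    (a b : R) :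
  continuous (fun z : T * R => h z.1 z.2) ->
  continuous (fun t => \int[mu]_(x in `[a, b]) h t x).
Proof.
move=> ch t0; have ch1 t : continuous (h t).
  by move=> x; exact: (cvg_comp _ _ (cvg_pair (cvg_cst t) cvg_id) (ch (t, x))).
apply/cvgrPdist_le => /= e e0.
(* Dividing by [l + 1] rather than by the length [l] also covers an empty or degenerate interval. *)
pose l := fine (mu `[a, b]); have l0 : 0 <= l by rewrite fine_ge0.
have l1 : 0 < l + 1 by rewrite ltr_wpDl.
pose e' := e / (l + 1); have e'0 : 0 < e' by rewrite divr_gt0.
have nearP : \forall t \near t0, `[a, b] `<=` (fun x => `|h t0 x - h t x| <= e').
  apply: (iffLR (compact_near_coveringP `[a, b]) (@segment_compact R a b) T
    (nbhs t0) (fun t x => `|h t0 x - h t x| <= e')) => x _.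
  have h2 : 0 < e' / 2 by rewrite divr_gt0.
  have /cvgrPdist_lt/(_ _ h2) := ch (t0, x).
  move=> -[[U V] /= [Ut Vx]] UV.
  exists (V, U) => //= -[x' t] /= [Vx' Ut'].
  have := UV (t, x') (conj Ut' Vx'); have := UV (t0, x') (conj (nbhs_singleton Ut) Vx').
  rewrite /= => h3 h4.
  rewrite (_ : h t0 x' - h t x' = - (h t0 x - h t0 x') + (h t0 x - h t x')); last by ring.
  rewrite (le_trans (ler_normD _ _))// normrN.
  by rewrite (le_trans (lerD (ltW h3) (ltW h4)))// -splitr.
near=> t.
have ht : `[a, b] `<=` (fun x => `|h t0 x - h t x| <= e') by near: t.
rewrite -RintegralB//; try exact: continuous_integrable.
have cB : continuous (fun x => h t0 x - h t x).
  by move=> x; apply: cvgB; exact: ch1.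
rewrite (le_trans (le_normr_Rintegral _ _))//; first exact: continuous_integrable.
rewrite (@le_trans _ _ (\int[mu]_(x in `[a, b]) (cst e' x)))//.
  apply: le_Rintegral => //.
  - apply: continuous_integrable => x; apply: cvg_norm; exact: cB.
  - by apply: continuous_integrable => x; exact: cvg_cst.
rewrite Rintegral_cst// -/l /e' mulrAC ler_pdivrMr// ler_pM2l//.
by rewrite lerDl.
Unshelve. all: by end_near. Qed.

(** The antiderivative is the integral from [a], hence controlled only to the right of [a]; it is
    applied with [a] chosen far enough to the left. *)
Lemma continuous_antiderivative (h : R -> R) (a : R) : continuous h ->
  exists H : R -> R, forall x, a < x -> is_derive x 1 H (h x).
Proof.
move=> ch; exists (fun x => \int[mu]_(t in `[a, x]) h t) => x ax.
have [||dH <-] := @continuous_FTC1_closed R h a x (x + 1) _ _ ax (ch x).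
- by rewrite ltrDl.
- exact: continuous_integrable.
by rewrite derive1E; exact: DeriveDef.
Qed.

Lemma Rintegral_antiderivative (f F : R -> R) (a b : R) : a < b ->
  continuous f -> (forall x, a <= x <= b -> is_derive x 1 F (f x)) ->
  \int[mu]_(x in `[a, b]) f x = F b - F a.
Proof.
move=> ab cf dF; rewrite /Rintegral (@continuous_FTC2 _ f F a b ab) //=.
- exact: continuous_subspaceT.
- have cF x : a <= x <= b -> {for x, continuous F}.
    by move=> /dF [? _]; apply/differentiable_continuous/derivable1_diffP.
  split.
  + by move=> x; rewrite in_itv /= => /andP[ax xb]; case: (dF x) => //; rewrite !ltW.
  + by apply: cvg_at_right_filter; apply: cF; rewrite lexx ltW.
  + by apply: cvg_at_left_filter; apply: cF; rewrite lexx ltW.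
- move=> x; rewrite in_itv /= => /andP[ax xb]; rewrite derive1E.
  by case: (dF x) => //; rewrite !ltW.
Qed.

(* The derivative of the left-hand side with respect to [c] is
   [h (- c) - h (L - c) = 0]. *)
Lemma Rintegral_periodic_shift (h : R -> R) (L c : R) : 0 < L ->
  continuous h -> (forall x, h (x + L) = h x) ->
  \int[mu]_(x in `[0, L]) h (x - c) = \int[mu]_(x in `[0, L]) h x.
Proof.
move=> L0 ch hL; pose Phi c := \int[mu]_(x in `[0, L]) h (x - c).
have -> : \int[mu]_(x in `[0, L]) h x = Phi 0.
  by rewrite /Phi; under [in RHS]eq_Rintegral do rewrite subr0.
apply: (@is_derive_0_is_cst R Phi) => c0.
(* This base point lies to the left of [u - c1] for all [u >= 0] and all [c1] at distance less than
   1 from [c0]. *)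
have [H dH] := continuous_antiderivative (- `|c0| - 1) ch.
have dHs u c1 : - `|c0| - 1 < u - c1 ->
    is_derive c1 1 (fun c => H (u - c)) (- h (u - c1)).
  move=> /dH dHu.
  rewrite -mulrN1; apply: (@is_derive1_comp _ H (fun c => u - c)) => //.
  by rewrite -[-1]add0r; apply: is_deriveB.
have PhiE c1 : `|c0 - c1| < 1 -> H (L - c1) - H (0 - c1) = Phi c1.
  move=> c01; have c1lt : - `|c0| - 1 < - c1.
    rewrite -opprD ltrN2 (le_lt_trans (ler_norm c1))// -ltrBlDl.
    by rewrite (le_lt_trans (lerB_dist _ _))// distrC.
  apply/esym.
  apply: (@Rintegral_antiderivative (fun x => h (x - c1)) (fun x => H (x - c1))) => //.
    by move=> x; apply: continuous_comp; last exact: ch;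
       apply: cvgB; [exact: cvg_id|exact: cvg_cst].
  move=> x /andP[x0 _].
  have dHx : is_derive (x - c1) 1 H (h (x - c1)).
    by apply: dH; rewrite (lt_le_trans c1lt)// lerDr.
  rewrite -[h _]mulr1; apply: (@is_derive1_comp _ H (fun x => x - c1)) => //.
  by rewrite -[X in is_derive _ _ _ X]subr0; apply: is_deriveB.
(* The formula for [Phi] holds only near [c0], which is enough for its derivative there; periodicity
   then cancels the two endpoint values of [h]. *)
apply: (@near_eq_is_derive _ _ _ (fun c => H (L - c) - H (0 - c))).
  near=> c1; apply: PhiE; near: c1.
  by apply: (@cvgr_dist_lt _ _ _ _ _ id) => //; exact: cvg_id.
rewrite -[X in is_derive _ _ _ X](_ : - h (L - c0) - - h (0 - c0) = 0); last first.
  by rewrite -(hL (0 - c0)) sub0r [- c0 + L]addrC subrr.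
have c0lt : - `|c0| - 1 < - c0.
  by rewrite -opprD ltrN2 (le_lt_trans (ler_norm c0))// ltrDl.
by apply: is_deriveB; apply: dHs; rewrite ?sub0r ?(lt_le_trans c0lt)// lerDr ltW.
Unshelve. all: by end_near. Qed.

End ParameterIntegral.

(** * The coupling functionals *)

Section Ccontinuous.
Variable R : realType.

(** Continuity is split into real and imaginary parts to match [Cintegral], which is defined
    componentwise. *)
Definition Ccontinuous (T : topologicalType) (f : T -> R[i]) :=
  continuous (fun t => complex.Re (f t)) /\ continuous (fun t => complex.Im (f t)).

Lemma Ccontinuous_comp (T U : topologicalType) (f : T -> U) (g : U -> R[i]) :
  continuous f -> Ccontinuous g -> Ccontinuous (fun t => g (f t)).
Proof.
by move=> cf [cg1 cg2]; split => t;
  [exact: (cvg_comp _ _ (cf t) (cg1 (f t)))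
  |exact: (cvg_comp _ _ (cf t) (cg2 (f t)))].
Qed.

Lemma CcontinuousZ (T : topologicalType) (f : T -> R[i]) (c : R[i]) :
  Ccontinuous f -> Ccontinuous (fun t => c * f t).
Proof.
move=> [cf1 cf2]; split => t.
  under eq_fun do rewrite ReM.
  by apply: cvgB; apply: cvgM; [exact: cvg_cst|exact: cf1|exact: cvg_cst|exact: cf2].
under eq_fun do rewrite ImM.
by apply: cvgD; apply: cvgM; [exact: cvg_cst|exact: cf2|exact: cvg_cst|exact: cf1].
Qed.

Lemma Ccontinuous_sum (T : topologicalType) (I : Type) (r : seq I)
    (f : I -> T -> R[i]) :
  (forall i, Ccontinuous (f i)) -> Ccontinuous (fun t => \sum_(i <- r) f i t).
Proof.
move=> cf; split => t.
  under eq_fun do rewrite Re_sum.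
  by apply: cvg_big => [|i _]; [exact: add_continuous|exact: (cf i).1].
under eq_fun do rewrite Im_sum.
by apply: cvg_big => [|i _]; [exact: add_continuous|exact: (cf i).2].
Qed.

Lemma continuous_pair (T U V : topologicalType) (f : T -> U) (g : T -> V) :
  continuous f -> continuous g -> continuous (fun t => (f t, g t)).
Proof. by move=> cf cg t; exact: (cvg_pair (cf t) (cg t)). Qed.

Lemma continuous_subcst (T : topologicalType) (f : T -> R) (c : R) :
  continuous f -> continuous (fun t => f t - c).
Proof. by move=> cf t; apply: cvgB; [exact: cf|exact: cvg_cst]. Qed.

Lemma continuous_fst1 (T U V : topologicalType) : continuous (fun z : T * U * V => z.1.1).
Proof. by move=> z; apply: (cvg_comp _ fst cvg_fst); exact: cvg_fst. Qed.

Lemma continuous_fst2 (T U V : topologicalType) : continuous (fun z : T * U * V => z.1.2).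
Proof. by move=> z; apply: (cvg_comp _ snd cvg_fst); exact: cvg_snd. Qed.

Lemma continuous_fst (T U : topologicalType) : continuous (fun z : T * U => z.1).
Proof. by move=> z; exact: cvg_fst. Qed.

Lemma continuous_snd (T U : topologicalType) : continuous (fun z : T * U => z.2).
Proof. by move=> z; exact: cvg_snd. Qed.

Lemma continuous_pairl (T U : topologicalType) (t : T) : continuous (fun u : U => (t, u)).
Proof. by move=> u; exact: (cvg_pair (cvg_cst t) cvg_id). Qed.

Lemma continuous_vec3 : continuous (fun z : R * R * R => vec3 z.1.1 z.1.2 z.2).
Proof.
have -> : (fun z : R * R * R => vec3 z.1.1 z.1.2 z.2) =
  (fun z => z.1.1 *: (delta_mx 0 0 : 'rV[R]_3) + z.1.2 *: delta_mx 0 1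
            + z.2 *: delta_mx 0 2).
  apply/funext => z; apply/rowP => i; rewrite !mxE /=.
  by case: i => -[|[|[|//]]] //= i; rewrite ?mulr0 ?mulr1 ?addr0 ?add0r.
move=> z; apply: cvgD; first apply: cvgD.
- by apply: cvgZr_tmp; exact: continuous_fst1.
- by apply: cvgZr_tmp; exact: continuous_fst2.
- by apply: cvgZr_tmp; exact: continuous_snd.
Qed.

End Ccontinuous.

(** * The univariate functional: continuity, linearity, conjugation, translation *)

Section UnivariateFunctional.
Variables (R : realType) (M : nat) (L : R).
Hypothesis L_gt0 : 0 < L.
Local Notation F1 := (@F1 R M L).
Local Notation mu := (@lebesgue_measure R).
Implicit Types (k : int).

(** This allows the functionals to be nested: after one variable has been consumed, the result is
    still continuous in the remaining ones, so the next mean value makes sense. *)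
Lemma F1_continuous (T : topologicalType) k (g : T -> R -> R[i]) :
  Ccontinuous (fun z : T * R => g z.1 z.2) -> Ccontinuous (fun t => F1 k (g t)).
Proof.
move=> cg; have cgt x : Ccontinuous (fun t => g t x).
  apply: (Ccontinuous_comp _ cg (f := fun t => (t, x))) => t.
  exact: (cvg_pair cvg_id (cvg_cst x)).
rewrite /Defs.F1; case: eqP => _.
  apply: CcontinuousZ; case: cg => cg1 cg2.
  by split; [exact: (@continuous_parameter_integral R T (fun t x => complex.Re (g t x)) 0 L cg1)
            |exact: (@continuous_parameter_integral R T (fun t x => complex.Im (g t x)) 0 L cg2)].
apply: CcontinuousZ; apply: Ccontinuous_sum => j.
by under eq_fun do rewrite mulrC; exact: CcontinuousZ.
Qed.

Lemma F1_sum k (I : finType) (c : I -> R) (g : I -> R -> R[i]) :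
  (forall i, Ccontinuous (g i)) ->
  F1 k (fun x => \sum_i (c i)%:C * g i x) = \sum_i (c i)%:C * F1 k (g i).
Proof.
move=> cg; rewrite /Defs.F1; case: eqP => _.
  rewrite (eq_bigr (fun i => (L^-1)%:C * ((c i)%:C * Cintegral mu `[0, L] (g i)))); last first.
    by move=> i _; ring.
  rewrite -mulr_sumr; congr (_ * _).
  apply: complex_eqP; rewrite /= ?Re_sum ?Im_sum.
    under eq_Rintegral do rewrite Re_sum.
    rewrite (@Rintegral_sum _ _ _ mu `[0, L] _ _
      (fun i x => complex.Re ((c i)%:C * g i x)))//; last first.
      by move=> i; apply: continuous_integrable; exact: (CcontinuousZ _ (cg i)).1.
    apply: eq_bigr => i _; rewrite ReM /= mul0r subr0.
    under eq_Rintegral do rewrite ReM /= mul0r subr0.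
    by rewrite RintegralZl//; apply: continuous_integrable; exact: (cg i).1.
  under eq_Rintegral do rewrite Im_sum.
  rewrite (@Rintegral_sum _ _ _ mu `[0, L] _ _
      (fun i x => complex.Im ((c i)%:C * g i x)))//; last first.
    by move=> i; apply: continuous_integrable; exact: (CcontinuousZ _ (cg i)).2.
  apply: eq_bigr => i _; rewrite ImM /= mul0r addr0.
  under eq_Rintegral do rewrite ImM /= mul0r addr0.
  by rewrite RintegralZl//; apply: continuous_integrable; exact: (cg i).2.
under eq_bigr do rewrite mulr_suml.
rewrite exchange_big mulr_sumr; apply: eq_bigr => i _.
by rewrite 3!mulr_sumr; apply: eq_bigr => j _; ring.
Qed.

(** Conjugation reverses the discrete exponentials, and the mean value, attached to [k = 0], is its
    own reflection. *)
Lemma F1_conj k (g : R -> R[i]) : Ccontinuous g ->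
  ((F1 k g)^*)%R = F1 (- k) (fun x => ((g x)^*)%R).
Proof.
move=> cg; rewrite /Defs.F1 oppr_eq0; case: eqP => _.
  rewrite rmorphM /= conj_real; congr (_ * _).
  apply: complex_eqP; rewrite ?Re_conj ?Im_conj /=.
    by under [RHS]eq_Rintegral do rewrite Re_conj.
  under [RHS]eq_Rintegral do rewrite Im_conj -mulN1r.
  by rewrite RintegralZl ?mulN1r//; apply: continuous_integrable; exact: cg.2.
rewrite rmorphM rmorph_sum fmorphV rmorph_nat; congr (_ * _).
apply: eq_bigr => j _; rewrite rmorphM /= conj_expi; congr (_ * expi _).
by rewrite rmorphN /= mulrN !mulNr.
Qed.

Lemma F1_shift (g : R -> R[i]) (c : R) : Ccontinuous g ->
  (forall x, g (x + L) = g x) -> F1 0 (fun x => g (x - c)) = F1 0 g.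
Proof.
move=> [cg1 cg2] gL; rewrite /Defs.F1 eqxx; congr (_ * _).
rewrite /Cintegral (@Rintegral_periodic_shift _ (fun x => complex.Re (g x)))//.
  rewrite (@Rintegral_periodic_shift _ (fun x => complex.Im (g x)))//.
  by move=> x; rewrite gL.
by move=> x; rewrite gL.
Qed.

End UnivariateFunctional.

Arguments F1_continuous {R M L T k} g _.

Section TrivariateFunctional.
Variables (R : realType) (K M : nat) (L : R).
Hypothesis L_gt0 : 0 < L.
Implicit Types (G : 'rV[R]_3 -> R[i]) (k : mode K).
Local Notation F1 := (@F1 R M L).
Local Notation F3 := (@F3 R K M L).

Lemma F3_continuous2 k G : Ccontinuous (fun z : R * R * R => G (vec3 z.1.1 z.1.2 z.2)) ->
  Ccontinuous (fun z : R * R => F1 (kval k 2) (fun x3 => G (vec3 z.1 z.2 x3))).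
Proof.
by move=> cG; apply: (@F1_continuous _ _ _ _ _ (fun (z : R * R) x => G (vec3 z.1 z.2 x))).
Qed.

Lemma F3_continuous1 k G : Ccontinuous (fun z : R * R * R => G (vec3 z.1.1 z.1.2 z.2)) ->
  Ccontinuous (fun x1 : R => F1 (kval k 1) (fun x2 =>
    F1 (kval k 2) (fun x3 => G (vec3 x1 x2 x3)))).
Proof.
move=> /(F3_continuous2 k) cG.
exact: (@F1_continuous R M L R (kval k 1)
  (fun x1 x2 => F1 (kval k 2) (fun x3 => G (vec3 x1 x2 x3))) cG).
Qed.

Lemma F3_sum k (I : finType) (c : I -> R) (G : I -> 'rV[R]_3 -> R[i]) :
  (forall i, Ccontinuous (fun z : R * R * R => G i (vec3 z.1.1 z.1.2 z.2))) ->
  F3 k (fun x => \sum_i (c i)%:C * G i x) = \sum_i (c i)%:C * F3 k (G i).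
Proof.
move=> cG; rewrite /Defs.F3.
have -> : (fun x1 : R => F1 (kval k 1) (fun x2 => F1 (kval k 2) (fun x3 =>
      \sum_i (c i)%:C * G i (vec3 x1 x2 x3)))) =
    (fun x1 => \sum_i (c i)%:C * F1 (kval k 1) (fun x2 => F1 (kval k 2) (fun x3 =>
      G i (vec3 x1 x2 x3)))).
  apply/funext => x1; rewrite -F1_sum; last first.
    move=> i; apply: (Ccontinuous_comp _ (F3_continuous2 k (cG i)) (f := fun x2 => (x1, x2))).
    exact: continuous_pairl.
  congr F1; apply/funext => x2; rewrite -F1_sum// => i.
  apply: (Ccontinuous_comp _ (cG i) (f := fun x3 => (x1, x2, x3))).
  exact: continuous_pairl.
by rewrite F1_sum// => i; exact: F3_continuous1.
Qed.

Lemma F3_conj k G : Ccontinuous (fun z : R * R * R => G (vec3 z.1.1 z.1.2 z.2)) ->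
  ((F3 k G)^*)%R = F3 (oppmode k) (fun x => ((G x)^*)%R).
Proof.
move=> cG; rewrite /Defs.F3 F1_conj; last exact: F3_continuous1.
rewrite !kval_oppmode; congr F1; apply/funext => x1; rewrite F1_conj; last first.
  apply: (Ccontinuous_comp _ (F3_continuous2 k cG) (f := fun x2 => (x1, x2))).
  exact: continuous_pairl.
congr F1; apply/funext => x2; rewrite F1_conj//.
apply: (Ccontinuous_comp _ cG (f := fun x3 => (x1, x2, x3))).
exact: continuous_pairl.
Qed.

End TrivariateFunctional.

(** * Coupling coefficients of the translated shape function *)

Section Shape.
Variables (R : realType) (K M : nat) (L : R) (S : 'rV[R]_3 -> R).
Hypothesis L_gt0 : 0 < L.
Hypothesis S_cont : continuous S.
Hypothesis S_periodic : forall a x, S (x + L *: delta_mx 0 a) = S x.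
Variable gamma : mode K -> R[i].
Hypothesis gamma_herm : forall k, gamma k = ((gamma (oppmode k))^*)%R.
Implicit Types (k : mode K) (y : 'rV[R]_3).
Local Notation F1 := (@F1 R M L).
Local Notation F3 := (@F3 R K M L).
Local Notation Pi3coef := (@Pi3coef R K M L gamma).

Lemma shape_continuous y :
  Ccontinuous (fun z : R * R * R => shape_at S y (vec3 z.1.1 z.1.2 z.2)).
Proof.
split => z; last exact: cvg_cst.
have cB : vec3 w.1.1 w.1.2 w.2 - y @[w --> z] --> vec3 z.1.1 z.1.2 z.2 - y.
  by apply: cvgB; [exact: continuous_vec3|exact: cvg_cst].
exact: (cvg_comp _ _ cB (@S_cont _)).
Qed.

Lemma vec3B (x1 x2 x3 : R) y : vec3 x1 x2 x3 - y =
  vec3 (x1 - y 0 0) (x2 - y 0 1) (x3 - y 0 2).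
Proof.
apply/rowP => i; rewrite !mxE.
by case: i => -[|[|[|//]]] //= i; congr (_ - y 0 _); apply/val_inj.
Qed.

Lemma vec3D_delta (x1 x2 x3 : R) (c : R) :
  [/\ vec3 (x1 + c) x2 x3 = vec3 x1 x2 x3 + c *: delta_mx 0 0,
      vec3 x1 (x2 + c) x3 = vec3 x1 x2 x3 + c *: delta_mx 0 1 &
      vec3 x1 x2 (x3 + c) = vec3 x1 x2 x3 + c *: delta_mx 0 2].
Proof.
split; apply/rowP => i; rewrite !mxE /=;
by case: i => -[|[|[|//]]] //= i; rewrite ?mulr0 ?mulr1 ?addr0 ?add0r.
Qed.

(** The coordinate of the particle along [a] acts only as a translation of the variable seen by the
    functional in direction [a]. Since [kval k a = 0], that functional is a mean over a period and
    does not see the translation. *)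
Lemma F3_shape_shift k y y' (a : 'I_3) : kval k a = 0 ->
  (forall b, b != a -> y' 0 b = y 0 b) -> F3 k (shape_at S y') = F3 k (shape_at S y).
Proof.
move=> ka0 yy'.
pose G (u v w : R) : R[i] := (S (vec3 u v w))%:C.
have GE z : (fun x1 => F1 (kval k 1) (fun x2 => F1 (kval k 2)
      (fun x3 => shape_at S z (vec3 x1 x2 x3)))) =
    (fun x1 => F1 (kval k 1) (fun x2 => F1 (kval k 2)
      (fun x3 => G (x1 - z 0 0) (x2 - z 0 1) (x3 - z 0 2)))).
  apply/funext => x1; congr F1; apply/funext => x2; congr F1; apply/funext => x3.
  by rewrite /shape_at vec3B.
have cG : Ccontinuous (fun z : R * R * R => G z.1.1 z.1.2 z.2).
  have -> : (fun z : R * R * R => G z.1.1 z.1.2 z.2) =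
      (fun z => shape_at S 0 (vec3 z.1.1 z.1.2 z.2)).
    by apply/funext => z; rewrite /shape_at subr0.
  exact: shape_continuous.
rewrite /Defs.F3 !GE.
(* The functionals are nested in the order 0, 1, 2. In each case the outer ones are removed by
   congruence, [h] collects what lies inside the one in direction [a], and both translates of [h]
   are compared with [h] itself. *)
case: a => -[|[|[|//]]] /= ia in ka0 yy'.
- have E : Ordinal ia = 0 by apply/val_inj.
  rewrite E in ka0 yy'; rewrite (yy' 1)// (yy' 2)// ka0.
  pose h x1 := F1 (kval k 1) (fun x2 => F1 (kval k 2)
      (fun x3 => G x1 (x2 - y 0 1) (x3 - y 0 2))).
  have hs c : F1 0 (fun x => h (x - c)) = F1 0 h.
    apply: F1_shift => //.
      apply: (@F1_continuous _ _ _ _ _ (fun x1 x2 => F1 (kval k 2)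
        (fun x3 => G x1 (x2 - y 0 1) (x3 - y 0 2)))).
      apply: (@F1_continuous _ _ _ _ _ (fun (z : R * R) x3 => G z.1 (z.2 - y 0 1) (x3 - y 0 2))).
      apply: (Ccontinuous_comp _ cG
        (f := fun z : R * R * R => (z.1.1, z.1.2 - y 0 1, z.2 - y 0 2))).
      apply: continuous_pair; first apply: continuous_pair.
      - exact: continuous_fst1.
      - by apply: continuous_subcst; exact: continuous_fst2.
      - by apply: continuous_subcst; exact: continuous_snd.
    move=> x; rewrite /h; congr F1; apply/funext => x2; congr F1; apply/funext => x3.
    by rewrite /G; have [-> _ _] := vec3D_delta x (x2 - y 0 1) (x3 - y 0 2) L;
       rewrite S_periodic.
  by rewrite [LHS](hs (y' 0 0)) [RHS](hs (y 0 0)).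
- have E : Ordinal ia = 1 by apply/val_inj.
  rewrite E in ka0 yy'; rewrite (yy' 0)// (yy' 2)// ka0.
  congr F1; apply/funext => x1.
  pose h x2 := F1 (kval k 2) (fun x3 => G (x1 - y 0 0) x2 (x3 - y 0 2)).
  have hs c : F1 0 (fun x => h (x - c)) = F1 0 h.
    apply: F1_shift => //.
      apply: (@F1_continuous _ _ _ _ _ (fun x2 x3 => G (x1 - y 0 0) x2 (x3 - y 0 2))).
      apply: (Ccontinuous_comp _ cG
        (f := fun z : R * R => (x1 - y 0 0, z.1, z.2 - y 0 2))).
      apply: continuous_pair; first apply: continuous_pair.
      - by move=> z; exact: cvg_cst.
      - exact: continuous_fst.
      - by apply: continuous_subcst; exact: continuous_snd.
    move=> x; rewrite /h; congr F1; apply/funext => x3.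
    by rewrite /G; have [_ -> _] := vec3D_delta (x1 - y 0 0) x (x3 - y 0 2) L;
       rewrite S_periodic.
  by rewrite [LHS](hs (y' 0 1)) [RHS](hs (y 0 1)).
- have E : Ordinal ia = 2 by apply/val_inj.
  rewrite E in ka0 yy'; rewrite (yy' 0)// (yy' 1)// ka0.
  congr F1; apply/funext => x1; congr F1; apply/funext => x2.
  pose h x3 := G (x1 - y 0 0) (x2 - y 0 1) x3.
  have hs c : F1 0 (fun x => h (x - c)) = F1 0 h.
    apply: F1_shift => //.
      apply: (Ccontinuous_comp _ cG
        (f := fun z : R => (x1 - y 0 0, x2 - y 0 1, z))).
      exact: continuous_pairl.
    move=> x; rewrite /h /G.
    by have [_ _ ->] := vec3D_delta (x1 - y 0 0) (x2 - y 0 1) x L; rewrite S_periodic.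
  by rewrite [LHS](hs (y' 0 2)) [RHS](hs (y 0 2)).
Qed.

Lemma Pi3coef_shape_shift k y y' (a : 'I_3) : kval k a = 0 ->
  (forall b, b != a -> y' 0 b = y 0 b) ->
  Pi3coef (shape_at S y') k = Pi3coef (shape_at S y) k.
Proof. by move=> ka0 yy'; rewrite /Defs.Pi3coef (F3_shape_shift ka0 yy'). Qed.

(** The shape function is real and the filter Hermitian, so conjugation only reflects the mode. *)
Lemma Pi3coef_shape_conj k y :
  ((Pi3coef (shape_at S y) k)^*)%R = Pi3coef (shape_at S y) (oppmode k).
Proof.
rewrite /Defs.Pi3coef rmorphM /= F3_conj; last exact: shape_continuous.
rewrite gamma_herm conjCK; congr (_ * F3 _ _).
by apply/funext => x; rewrite conj_real.
Qed.

Lemma Pi3coef_rho N (q : 'I_N -> R) (s : state R K N) k :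
  Pi3coef (rho q S s) k = \sum_(p < N) (q p)%:C * Pi3coef (shape_at S (pos s p)) k.
Proof.
rewrite /Defs.Pi3coef (@F3_sum _ _ _ _ k _ q (fun p => shape_at S (pos s p))); last first.
  by move=> p; exact: shape_continuous.
by rewrite mulr_sumr; apply: eq_bigr => p _; ring.
Qed.

Lemma Pi3_rho N (q : 'I_N -> R) (s : state R K N) x :
  Pi3 M L gamma (rho q S s) x =
  \sum_(p < N) (q p)%:C * Pi3 M L gamma (shape_at S (pos s p)) x.
Proof.
rewrite /Pi3; under eq_bigr do rewrite Pi3coef_rho mulr_suml.
rewrite exchange_big; apply: eq_bigr => p _; rewrite mulr_sumr.
by apply: eq_bigr => k _; rewrite mulrA.
Qed.

End Shape.

(** * Orthogonality of the Fourier modes on the cube *)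

Section RectangleIntegral.
Context d1 d2 (T1 : measurableType d1) (T2 : measurableType d2) (R : realType).
Variable m1 : {sigma_finite_measure set T1 -> \bar R}.
Variable m2 : {sigma_finite_measure set T2 -> \bar R}.

(** Extension by zero reduces this to Fubini on the whole product. Integrability of every section
    keeps the inner integrals finite, so that passing through [fine] loses nothing. *)
Lemma Rintegral_setX (D1 : set T1) (D2 : set T2) (f : T1 * T2 -> R) :
  measurable D1 -> measurable D2 ->
  (m1 \x m2)%E.-integrable (D1 `*` D2) (EFin \o f) ->
  (forall x, m2.-integrable D2 (fun y => (f (x, y))%:E)) ->
  \int[(m1 \x m2)%E]_(z in D1 `*` D2) f z =
  \int[m1]_(x in D1) \int[m2]_(y in D2) f (x, y).
Proof.
move=> mD1 mD2 intf intfx; rewrite /Rintegral; congr fine.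
rewrite integral_mkcond -integral12_prod_meas1; last first.
  by apply/(integrable_mkcond _ _).1 => //; exact: measurableX.
rewrite [RHS]integral_mkcond; apply: eq_integral => x _.
rewrite /fubini_F patchE; case: ifPn => xD1.
  rewrite fineK; last exact: integrable_fin_num.
  rewrite [RHS]integral_mkcond; apply: eq_integral => y _.
  by rewrite !patchE in_setX xD1.
rewrite -[RHS](integral0 m2 setT); apply: eq_integral => y _.
by rewrite patchE in_setX (negbTE xD1).
Qed.

End RectangleIntegral.

(* The library's canonical sigma-finite structure on [product_measure1] is the one
   for products of subprobabilities; this copy carries the structure needed to
   integrate on the cube by Fubini. *)
Definition lebesgue2 (R : realType) :
    set (measurableTypeR R * measurableTypeR R)%type -> \bar R :=
  (@lebesgue_measure R \x @lebesgue_measure R)%E.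

HB.instance Definition _ (R : realType) := Measure.on (@lebesgue2 R).

(** Squares of an increasing exhaustion of the line by sets of finite measure exhaust the plane: the
    larger of the indices of the two coordinates serves for both. *)
Lemma sigma_finite_lebesgue2 (R : realType) : sigma_finite setT (@lebesgue2 R).
Proof.
have /sigma_finiteP[F [TF ndF Foo]] := sigma_finiteT (@lebesgue_measure R).
exists (fun n => F n `*` F n) => [|n].
  apply/seteqP; split => // -[x y] _.
  have [i _ Fix] : (\bigcup_n F n) x by rewrite -TF.
  have [j _ Fjy] : (\bigcup_n F n) y by rewrite -TF.
  exists (maxn i j) => //; split.
    by move: Fix; exact/subsetPset/ndF/leq_maxl.
  by move: Fjy; exact/subsetPset/ndF/leq_maxr.
have [mF Flty] := Foo n; split; first exact: measurableX.
have -> : lebesgue2 (F n `*` F n) = (lebesgue_measure (F n) * lebesgue_measure (F n))%E.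
  exact: product_measure1E.
by rewrite lte_mul_pinfty// ge0_fin_numE.
Qed.

HB.instance Definition _ (R : realType) :=
  Measure_isSigmaFinite.Build _ _ _ (@lebesgue2 R) (@sigma_finite_lebesgue2 R).

(** * Integrals of cosines over intervals, squares and cubes *)

Section Fourier.
Variables (R : realType) (L : R).
Hypothesis L_gt0 : 0 < L.
Local Notation mu := (@lebesgue_measure R).

Lemma lebesgue_measure_itv0L : lebesgue_measure (`[0, L] : set R) = L%:E.
Proof. by rewrite lebesgue_measure_itv /= lte_fin L_gt0 -EFinB subr0. Qed.

Lemma cos_sin_2pi_int (n : int) (t : R) :
  cos (2 * pi * n%:~R + t) = cos t /\ sin (2 * pi * n%:~R + t) = sin t.
Proof.
have nat_case (j : nat) (u : R) :
    cos (2 * pi * j%:R + u) = cos u /\ sin (2 * pi * j%:R + u) = sin u.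
  rewrite addrC (_ : 2 * pi * j%:R = (pi *+ 2) *+ j); last by rewrite mulr_natr mulr_natl.
  by rewrite (periodicn (@cosD2pi R)) (periodicn (@sinD2pi R)).
case: n => j; first exact: nat_case.
rewrite NegzE mulrNz mulrN.
have [<- <-] := nat_case j.+1 (- (2 * pi * j.+1%:R) + t).
by rewrite !addNKr.
Qed.

(** The free phase [t] serves twice: it absorbs the other variables in iterated integrals, and
    [t = - (pi / 2)] gives the sine. *)
Lemma Rintegral_cos (n : int) (t : R) :
  \int[mu]_(x in `[0, L]) cos (2 * pi * n%:~R * x / L + t) =
  (n == 0)%:R * L * cos t.
Proof.
case: eqP => [->|/eqP n0]; rewrite ?mul1r ?mul0r.
  under eq_Rintegral do rewrite mulr0 !mul0r add0r.
  by rewrite Rintegral_cst// mulrC; congr (_ * _);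
     exact: (congr1 fine lebesgue_measure_itv0L).
pose w : R := 2 * pi * n%:~R / L.
have w0 : w != 0.
  by rewrite !mulf_neq0// ?invr_eq0 ?intr_eq0// ?pnatr_eq0// lt0r_neq0// pi_gt0.
have wE x : 2 * pi * n%:~R * x / L + t = w * x + t by rewrite /w; ring.
under eq_Rintegral do rewrite wE.
have dF (x : R) : is_derive x 1 (fun x : R => w^-1 * sin (w * x + t)) (cos (w * x + t)).
  have dl : is_derive x 1 (fun x : R => w * x + t) w.
    rewrite -[X in is_derive _ _ _ X]addr0 -[w in X in is_derive _ _ _ X]mulr1.
    exact: is_deriveD.
  have ds := @is_derive1_comp _ (@sin R) (fun x : R => w * x + t) x _ _
    (is_derive_sin (w * x + t)) dl.
  rewrite -[X in is_derive _ _ _ X](_ : w^-1 * (cos (w * x + t) * w) = _); last by field.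
  exact: is_deriveZ.
transitivity (w^-1 * sin (w * L + t) - w^-1 * sin (w * 0 + t)).
  apply: (@Rintegral_antiderivative R (fun x => cos (w * x + t))
    (fun x => w^-1 * sin (w * x + t)) 0 L) => // x.
  apply: (@continuous_comp _ _ _ (fun x => w * x + t) (@cos R)); last exact: continuous_cos.
  by apply: cvgD; [apply: cvgM; [exact: cvg_cst|exact: cvg_id]|exact: cvg_cst].
have -> : w * L = 2 * pi * n%:~R by rewrite /w divfK// gt_eqF.
by rewrite (cos_sin_2pi_int n t).2 mulr0 add0r subrr.
Qed.

Local Notation cube := (`[0, L] `*` `[0, L] `*` `[0, L] : set (R * R * R)).
Local Notation T3 := (measurableTypeR R * measurableTypeR R * measurableTypeR R)%type.

Lemma measurable_cube : measurable (cube : set T3).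
Proof. by apply: measurableX => //; exact: measurableX. Qed.

Lemma lebesgue_square :
  lebesgue2 (`[0, L] `*` `[0, L] : set (measurableTypeR R * measurableTypeR R)) =
  (L * L)%:E.
Proof.
transitivity (mu `[0%R, L]%classic * mu `[0%R, L]%classic)%E.
  exact: product_measure1E.
by rewrite EFinM; congr (_ * _)%E; exact: lebesgue_measure_itv0L.
Qed.

Lemma lebesgue_cube : @lebesgue3 R (cube : set T3) = (L * L * L)%:E.
Proof.
transitivity (lebesgue2 (`[0%R, L] `*` `[0%R, L]) * mu `[0%R, L]%classic)%E.
  by apply: product_measure1E => //; exact: measurableX.
rewrite [RHS]EFinM; congr (_ * _)%E; last exact: lebesgue_measure_itv0L.
exact: lebesgue_square.
Qed.

Lemma bounded_integrable d (T : measurableType d) (nu : {measure set T -> \bar R})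
    (D : set T) (f : T -> R) (C : R) :
  measurable D -> (nu D < +oo)%E -> measurable_fun D f ->
  (forall x, `|f x| <= C) -> nu.-integrable D (EFin \o f).
Proof.
move=> mD Dlty mf fC; apply: measurable_bounded_integrable => //.
exists C; split; first exact: num_real.
by move=> M CM x _ /=; rewrite (le_trans (fC x))// ltW.
Qed.

(* The innermost integration variable of Fubini comes first, so that each
   integration leaves a cosine of the same shape. *)
Definition phase2 (n0 n1 : int) (z : R * R) : R :=
  2 * pi * n1%:~R * z.2 / L + 2 * pi * n0%:~R * z.1 / L.

Definition phase3 (n0 n1 n2 : int) (z : R * R * R) : R :=
  2 * pi * n2%:~R * z.2 / L + phase2 n0 n1 z.1.

Lemma phase2_pair n0 n1 x y t : phase2 n0 n1 (x, y) + t =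
  2 * pi * n1%:~R * y / L + (2 * pi * n0%:~R * x / L + t).
Proof. by rewrite addrA. Qed.

Lemma phase3_pair n0 n1 n2 z y t : phase3 n0 n1 n2 (z, y) + t =
  2 * pi * n2%:~R * y / L + (phase2 n0 n1 z + t).
Proof. by rewrite addrA. Qed.

Lemma measurable_phase2 n0 n1 :
  measurable_fun (setT : set (measurableTypeR R * measurableTypeR R)) (phase2 n0 n1).
Proof.
by apply: measurable_realfun.measurable_funD;
  apply: measurable_realfun.measurable_funM => //; exact: measurable_realfun.measurable_funM.
Qed.

Lemma measurable_phase3 n0 n1 n2 : measurable_fun (setT : set T3) (phase3 n0 n1 n2).
Proof.
apply: measurable_realfun.measurable_funD.
  by apply: measurable_realfun.measurable_funM => //; exact: measurable_realfun.measurable_funM.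
exact: (measurableT_comp (measurable_phase2 n0 n1) (@measurable_fst _ _ _ _)).
Qed.

Lemma measurable_cos d (T : measurableType d) (D : set T) (f : T -> R) (t : R) :
  measurable_fun D f -> measurable_fun D (fun z => cos (f z + t)).
Proof.
move=> mf; apply: (@measurableT_comp _ _ _ _ _ _ (@cos R)).
  by apply: measurable_realfun.continuous_measurable_fun; exact: continuous_cos.
exact: measurable_realfun.measurable_funD.
Qed.

Lemma integrable_cos (n : int) t :
  mu.-integrable `[0, L] (EFin \o (fun x => cos (2 * pi * n%:~R * x / L + t))).
Proof.
apply: continuous_integrable => x.
apply: (@continuous_comp _ _ _ (fun x => 2 * pi * n%:~R * x / L + t) (@cos R));
  last exact: continuous_cos.
apply: cvgD; last exact: cvg_cst.
by apply: cvgM; [apply: cvgM; [exact: cvg_cst|exact: cvg_id]|exact: cvg_cst].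
Qed.

Lemma integrable_cos_phase2 n0 n1 t :
  (@lebesgue2 R).-integrable (`[0, L] `*` `[0, L]) (EFin \o (fun z => cos (phase2 n0 n1 z + t))).
Proof.
apply: (@bounded_integrable _ _ _ _ _ 1); first exact: measurableX.
- by move: (ltry (L * L)); rewrite -lebesgue_square.
- by apply: measurable_funTS; apply: measurable_cos; exact: measurable_phase2.
- by move=> z; exact: cos_max.
Qed.

Lemma integrable_cos_phase3 n0 n1 n2 t :
  (@lebesgue3 R).-integrable (cube : set T3) (EFin \o (fun z => cos (phase3 n0 n1 n2 z + t))).
Proof.
apply: (@bounded_integrable _ _ _ _ _ 1); first exact: measurable_cube.
- by move: (ltry (L * L * L)); rewrite -lebesgue_cube.
- by apply: measurable_funTS; apply: measurable_cos; exact: measurable_phase3.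
- by move=> z; exact: cos_max.
Qed.

Lemma Rintegral_cos_phase2 n0 n1 t :
  \int[@lebesgue2 R]_(z in `[0, L] `*` `[0, L]) cos (phase2 n0 n1 z + t) =
  (n1 == 0)%:R * L * ((n0 == 0)%:R * L * cos t).
Proof.
rewrite Rintegral_setX//; first last.
- move=> x; move: (integrable_cos n1 (2 * pi * n0%:~R * x / L + t)).
  by apply: eq_integrable => // y _; congr (cos _)%:E; rewrite phase2_pair.
- exact: integrable_cos_phase2.
under eq_Rintegral do (under eq_Rintegral do rewrite phase2_pair; rewrite Rintegral_cos).
by rewrite RintegralZl ?Rintegral_cos//; exact: integrable_cos.
Qed.

Lemma Rintegral_cos_phase3 n0 n1 n2 t :
  \int[@lebesgue3 R]_(z in (cube : set T3)) cos (phase3 n0 n1 n2 z + t) =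
  (n2 == 0)%:R * L * ((n1 == 0)%:R * L * ((n0 == 0)%:R * L * cos t)).
Proof.
transitivity (\int[@lebesgue2 R]_(z in `[0, L] `*` `[0, L])
    \int[mu]_(y in `[0, L]) cos (phase3 n0 n1 n2 (z, y) + t)).
  rewrite -(@Rintegral_setX _ _ _ _ R (@lebesgue2 R) mu (`[0, L] `*` `[0, L]) `[0, L]
    (fun z => cos (phase3 n0 n1 n2 z + t))).
  - congr fine; apply: eq_measure_integral => A mA _.
  - exact: measurableX.
  - exact: measurable_itv.
  - exact: integrable_cos_phase3.
  - move=> z; move: (integrable_cos n2 (phase2 n0 n1 z + t)).
    by apply: eq_integrable => // y _; congr (cos _)%:E; rewrite phase3_pair.
under eq_Rintegral do (under eq_Rintegral do rewrite phase3_pair; rewrite Rintegral_cos).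
rewrite RintegralZl ?Rintegral_cos_phase2//; last exact: integrable_cos_phase2.
exact: measurableX.
Qed.

Definition Cintegrable d (T : measurableType d) (nu : {measure set T -> \bar R})
    (D : set T) (f : T -> R[i]) :=
  nu.-integrable D (EFin \o (fun x => complex.Re (f x))) /\
  nu.-integrable D (EFin \o (fun x => complex.Im (f x))).

Lemma CintegralZ d (T : measurableType d) (nu : {measure set T -> \bar R})
    (D : set T) (c : R[i]) (f : T -> R[i]) :
  measurable D -> Cintegrable nu D f ->
  Cintegrable nu D (fun x => c * f x) /\
  Cintegral nu D (fun x => c * f x) = c * Cintegral nu D f.
Proof.
move=> mD [i1 i2]; split.
  split.
    have := integrableB mD (integrableZl mD (complex.Re c) i1)
      (integrableZl mD (complex.Im c) i2).
    apply: eq_integrable => // x _ /=; by rewrite ReM.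
  have := integrableD mD (integrableZl mD (complex.Re c) i2)
    (integrableZl mD (complex.Im c) i1).
  by apply: eq_integrable => // x _ /=; rewrite ImM.
have iZ (a : R) (g : T -> R) : nu.-integrable D (EFin \o g) ->
    nu.-integrable D (EFin \o (fun x => a * g x)).
  by move=> ig; have := integrableZl mD a ig; apply: eq_integrable.
apply: complex_eqP; rewrite ?ReM ?ImM /=.
  under eq_Rintegral do rewrite ReM.
  by rewrite RintegralB// ?RintegralZl//; exact: iZ.
under eq_Rintegral do rewrite ImM.
by rewrite RintegralD// ?RintegralZl//; exact: iZ.
Qed.

Lemma Cintegral_sum d (T : measurableType d) (nu : {measure set T -> \bar R})
    (D : set T) (I : Type) (r : seq I) (f : I -> T -> R[i]) :
  measurable D -> (forall i, Cintegrable nu D (f i)) ->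
  Cintegral nu D (fun x => \sum_(i <- r) f i x) =
  \sum_(i <- r) Cintegral nu D (f i).
Proof.
move=> mD fi; apply: complex_eqP; rewrite ?Re_sum ?Im_sum /=.
  under eq_Rintegral do rewrite Re_sum.
  by rewrite (@Rintegral_sum _ _ _ _ _ _ _ (fun i x => complex.Re (f i x)))// => i;
     exact: (fi i).1.
under eq_Rintegral do rewrite Im_sum.
by rewrite (@Rintegral_sum _ _ _ _ _ _ _ (fun i x => complex.Im (f i x)))// => i;
   exact: (fi i).2.
Qed.

Section Modes.
Variable K : nat.
Implicit Types k l : mode K.
Local Notation vec z := (vec3 z.1.1 z.1.2 z.2).

Lemma LambdaM k l (z : R * R * R) : Lambda L k (vec z) * Lambda L l (vec z) =
  expi (phase3 (kval k 0 + kval l 0) (kval k 1 + kval l 1) (kval k 2 + kval l 2) z).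
Proof.
rewrite /Lambda -expiD; congr expi; rewrite !big_ord_recl !big_ord0 !mxE /=.
have -> : lift ord0 (lift ord0 ord0) = 2 :> 'I_3 by apply/val_inj.
have -> : lift ord0 ord0 = 1 :> 'I_3 by apply/val_inj.
rewrite /phase3 /phase2 !rmorphD /=; ring.
Qed.

(** The product of two modes is the exponential with the summed frequencies, whose integral vanishes
    unless all three sums are zero. No conjugate is taken, hence the partner of [k] is its
    opposite. *)
Lemma Lambda_orthogonal k l :
  Cintegrable (@lebesgue3 R) (cube : set T3)
    (fun z => Lambda L k (vec z) * Lambda L l (vec z)) /\
  Cintegral (@lebesgue3 R) (cube : set T3)
    (fun z => Lambda L k (vec z) * Lambda L l (vec z)) =
  if l == oppmode k then (L ^+ 3)%:C else 0.
Proof.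
pose n a := kval k a + kval l a.
have ReE z : complex.Re (Lambda L k (vec z) * Lambda L l (vec z)) =
    cos (phase3 (n 0) (n 1) (n 2) z + 0) by rewrite LambdaM addr0.
(* Writing the sine as a shifted cosine puts both parts under [Rintegral_cos_phase3]; the imaginary
   part then carries the factor [cos (pi / 2) = 0]. *)
have ImE z : complex.Im (Lambda L k (vec z) * Lambda L l (vec z)) =
    cos (phase3 (n 0) (n 1) (n 2) z + - (pi / 2)) by rewrite LambdaM cosBpihalf.
split.
  split.
    have := integrable_cos_phase3 (n 0) (n 1) (n 2) 0; apply: eq_integrable => // [|z _].
      exact: measurable_cube.
    by rewrite /= -ReE.
  have := integrable_cos_phase3 (n 0) (n 1) (n 2) (- (pi / 2));
    apply: eq_integrable => // [|z _].
    exact: measurable_cube.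
  by rewrite /= -ImE.
rewrite /Cintegral; under eq_Rintegral do rewrite ReE.
under [X in _ +i* X]eq_Rintegral do rewrite ImE.
rewrite !Rintegral_cos_phase3 cos0 cosN cos_pihalf !mulr0 mulr1.
have kl a : (n a == 0) = (val (l a) == val (oppmode k a)).
  rewrite /n addrC addr_eq0 -kval_oppmode /kval; apply/eqP/eqP => [|->//].
  by move=> /addIr [].
rewrite !kl; have [->|/eqP lk] := eqVneq l (oppmode k).
  by rewrite !eqxx !mul1r; congr (_ +i* _); ring.
case: (val (l 2) =P _) => l2; last by rewrite !mul0r.
case: (val (l 1) =P _) => l1; last by rewrite !(mul0r, mulr0).
case: (val (l 0) =P _) => l0; last by rewrite !(mul0r, mulr0).
exfalso; apply: lk; apply/ffunP => a; apply/val_inj.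
case: a => -[|[|[|//]]] ia; [rewrite (_ : Ordinal ia = 0)//
  |rewrite (_ : Ordinal ia = 1)//|rewrite (_ : Ordinal ia = 2)//]; exact/val_inj.
Qed.

End Modes.
End Fourier.

(** * Derivatives and integrals of trigonometric fields *)

Section ComplexDerivative.
Variable R : realType.
Implicit Types (f g : R -> R[i]) (t : R) (c d e : R[i]).

Lemma is_Cderive_cst c t : is_Cderive (fun _ => c) t 0.
Proof. by split; exact: is_derive_cst. Qed.

Lemma is_CderiveD f g t d e : is_Cderive f t d -> is_Cderive g t e ->
  is_Cderive (fun u => f u + g u) t (d + e).
Proof.
move=> [f1 f2] [g1 g2]; split.
  by under eq_fun do rewrite ReD; rewrite ReD; exact: is_deriveD.
by under eq_fun do rewrite ImD; rewrite ImD; exact: is_deriveD.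
Qed.

Lemma is_CderiveM f g t d e : is_Cderive f t d -> is_Cderive g t e ->
  is_Cderive (fun u => f u * g u) t (d * g t + f t * e).
Proof.
move=> [f1 f2] [g1 g2]; split.
  under eq_fun do rewrite ReM.
  apply: (@is_derive_eq _ _ _ _ _ _ _ _ (is_deriveB (is_deriveM f1 g1) (is_deriveM f2 g2))).
  by rewrite /GRing.scale /= ReD !ReM; ring.
under eq_fun do rewrite ImM.
apply: (@is_derive_eq _ _ _ _ _ _ _ _ (is_deriveD (is_deriveM f1 g2) (is_deriveM f2 g1))).
by rewrite /GRing.scale /= ImD !ImM; ring.
Qed.

Lemma is_CderiveZ c f t d : is_Cderive f t d ->
  is_Cderive (fun u => c * f u) t (c * d).
Proof.
by move=> fd; have := is_CderiveM (is_Cderive_cst c t) fd; rewrite mul0r add0r.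
Qed.

Lemma is_CderiveB f g t d e : is_Cderive f t d -> is_Cderive g t e ->
  is_Cderive (fun u => f u - g u) t (d - e).
Proof.
move=> fd /(is_CderiveZ (-1)) ge; rewrite -mulN1r.
by under eq_fun do rewrite -mulN1r; exact: is_CderiveD.
Qed.

Lemma is_Cderive_sum (I : Type) (r : seq I) (h : I -> R -> R[i]) (dh : I -> R[i]) t :
  (forall i, is_Cderive (h i) t (dh i)) ->
  is_Cderive (fun u => \sum_(i <- r) h i u) t (\sum_(i <- r) dh i).
Proof.
move=> hd; elim: r => [|i r IHr].
  by rewrite big_nil; under eq_fun do rewrite big_nil; exact: is_Cderive_cst.
by rewrite big_cons; under eq_fun do rewrite big_cons; exact: is_CderiveD.
Qed.

Lemma is_Cderive_0_is_cst f t t' : (forall u, is_Cderive f u 0) -> f t = f t'.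
Proof.
by move=> fd; apply: complex_eqP;
  [apply: (@is_derive_0_is_cst _ (fun u => complex.Re (f u)))
  |apply: (@is_derive_0_is_cst _ (fun u => complex.Im (f u)))] => u; case: (fd u).
Qed.

Lemma is_Cderive_expi (w v t : R) :
  is_Cderive (fun u => expi (u * w + v)) t ((w *i) * expi (t * w + v)).
Proof.
have dl : is_derive t 1 (fun u : R => u * w + v) w.
  apply: (@is_derive_eq _ _ _ _ _ _ _ _ (is_deriveD (is_deriveM (is_derive_id t 1)
    (is_derive_cst w t 1)) (is_derive_cst v t 1))).
  by rewrite /GRing.scale /= mulr0 add0r addr0 mulr1.
split; rewrite ?ReM ?ImM /= mul0r ?sub0r ?add0r mulrC -?mulNr.
  exact: (@is_derive1_comp _ (@cos R) (fun u : R => u * w + v) t _ _ (is_derive_cos _) dl).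
exact: (@is_derive1_comp _ (@sin R) (fun u : R => u * w + v) t _ _ (is_derive_sin _) dl).
Qed.

(** Restricting to the line through [x] makes the one-variable rules for [is_Cderive] available for
    partial derivatives. *)
Lemma partialE (a : 'I_3) (F : 'rV[R]_3 -> R[i]) (x : 'rV[R]_3) d :
  is_Cderive (fun h => F (h *: delta_mx 0 a + x)) 0 d -> partial a F x = d.
Proof.
have dE (g : 'rV[R]_3 -> R) (e : R) :
    is_derive (0 : R) 1 (fun h : R => g (h *: delta_mx 0 a + x)) e ->
    'D_(delta_mx 0 a) g x = e.
  case=> _ <-; rewrite /derive; do 2 f_equal; apply/funext => h /=.
  by rewrite addr0 scale0r add0r /GRing.scale /= mulr1.
move=> [d1 d2]; rewrite /partial.
rewrite (dE (fun y => complex.Re (F y)) _ d1) (dE (fun y => complex.Im (F y)) _ d2).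
by case: d {d1 d2}.
Qed.

End ComplexDerivative.

(** * Trigonometric fields: divergence, uniqueness of coefficients, bilinear Parseval identity *)

Section Modes.
Variables (R : realType) (K : nat) (L : R).
Hypothesis L_gt0 : 0 < L.
Implicit Types (k l : mode K) (c e f : mode K -> 'rV[R[i]]_3).

Lemma oppmodeK : involutive (@oppmode K).
Proof. by move=> k; apply/ffunP => a; rewrite !ffunE rev_ordK. Qed.

Lemma sum_oppmode (V : nmodType) (F : mode K -> V) :
  \sum_k F (oppmode k) = \sum_k F k.
Proof. by rewrite [RHS](reindex_inj (can_inj oppmodeK)). Qed.

Lemma ik_oppmode k a : ik L (oppmode k) 0 a = - ik L k 0 a.
Proof.
by rewrite !mxE kval_oppmode; apply: complex_eqP; rewrite /= ?oppr0// rmorphN mulrN mulNr.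
Qed.

Lemma conj_ik k a : ((ik L k 0 a)^*)%R = - ik L k 0 a.
Proof. by rewrite !mxE; apply: complex_eqP; rewrite ?Re_conj ?Im_conj //= oppr0. Qed.

Lemma ik_eq0 k a : (ik L k 0 a == 0) = (kval k a == 0).
Proof.
rewrite mxE eq_complex /= eqxx /= !mulf_eq0 invr_eq0 intr_eq0 pnatr_eq0 /=.
by rewrite [L == 0]gt_eqF// [pi == 0]gt_eqF ?pi_gt0// orbF.
Qed.

Lemma trig_fieldE c x a : trig_field L c x 0 a = \sum_k Lambda L k x * c k 0 a.
Proof. by rewrite summxE; apply: eq_bigr => k _; rewrite mxE. Qed.

Lemma divergence_trig_field c x :
  divergence (trig_field L c) x = \sum_k (\sum_a ik L k 0 a * c k 0 a) * Lambda L k x.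
Proof.
rewrite /divergence.
have pE a : partial a (fun y => trig_field L c y 0 a) x =
    \sum_k ik L k 0 a * Lambda L k x * c k 0 a.
  apply: partialE; under eq_fun do rewrite trig_fieldE.
  apply: is_Cderive_sum => k; under eq_fun do rewrite mulrC.
  rewrite [X in is_Cderive _ _ X]mulrC.
  apply: is_CderiveZ; pose th := 2 * pi * (\sum_(b < 3) (kval k b)%:~R * x 0 b) / L.
  have := is_Cderive_expi (2 * pi * (kval k a)%:~R / L) th 0.
  rewrite mul0r add0r mxE /Lambda -/th.
  congr (is_Cderive _ _ _); apply/funext => h; congr expi; rewrite /th.
  have -> : \sum_(b < 3) (kval k b)%:~R * (h *: delta_mx 0 a + x) 0 b =
      h * (kval k a)%:~R + \sum_(b < 3) (kval k b)%:~R * x 0 b.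
    under eq_bigr do rewrite !mxE /= mulrDr.
    rewrite big_split /=; congr (_ + _); rewrite (bigD1 a)//= eqxx mulr1 mulrC.
    by rewrite big1 ?addr0 // => b /negbTE ->; rewrite !mulr0.
  by ring.
under eq_bigr do rewrite pE.
rewrite exchange_big; apply: eq_bigr => k _; rewrite mulr_suml.
by apply: eq_bigr => a _; rewrite mulrAC.
Qed.

Local Notation cube := (`[0, L] `*` `[0, L] `*` `[0, L] : set (R * R * R)).
Local Notation vec z := (vec3 z.1.1 z.1.2 z.2).

(** The free index type covers both uses: a single sum tested against one fixed mode, and the double
    sum in a product of two fields. *)
Lemma Cintegral_LambdaM (I : finType) (k l : I -> mode K) (c : I -> R[i]) :
  Cintegral (@lebesgue3 R) cube
    (fun z => \sum_i c i * (Lambda L (k i) (vec z) * Lambda L (l i) (vec z))) =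
  \sum_i c i * (if l i == oppmode (k i) then (L ^+ 3)%:C else 0).
Proof.
have cZ i := CintegralZ (c i) (measurable_cube L) (Lambda_orthogonal L_gt0 (k i) (l i)).1.
apply: eq_trans.
  apply: Cintegral_sum; first exact: measurable_cube.
  by move=> i; exact: (cZ i).1.
by apply: eq_bigr => i _; apply: (eq_trans (cZ i).2);
   rewrite (Lambda_orthogonal L_gt0 (k i) (l i)).2.
Qed.

(** Integrating the vanishing sum against the mode [oppmode l] isolates [c l] times the volume of
    the cube. *)
Lemma Lambda_free (c : mode K -> R[i]) :
  (forall x, \sum_k c k * Lambda L k x = 0) -> forall k, c k = 0.
Proof.
move=> c0 l.
have := @Cintegral_LambdaM (mode K) id (fun _ => oppmode l) c.
rewrite (_ : (fun z => _) = (fun z => 0)); last first.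
  apply/funext => z; under eq_bigr do rewrite mulrA; by rewrite -mulr_suml c0 mul0r.
rewrite /Cintegral /Rintegral /= integral0.
rewrite (bigD1 l)//= eqxx big1 ?addr0 => [/esym/eqP|k kl].
  rewrite -[0 +i* 0]/(0 : R[i]) mulf_eq0 => /orP[/eqP//|].
  by rewrite eq_complex /= eqxx andbT expf_eq0 /= gt_eqF.
by rewrite (inj_eq (can_inj oppmodeK)) eq_sym (negbTE kl) mulr0.
Qed.

(** This is Parseval's identity without conjugation: in the double sum over pairs of modes only
    opposite modes survive. *)
Lemma integral_cube_cross e f :
  integral_cube L (fun x => cross (trig_field L e x) (trig_field L f x)) =
  (L ^+ 3)%:C *: \sum_k cross (e k) (f (oppmode k)).
Proof.
apply/rowP => b; rewrite mxE [RHS]mxE summxE.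
pose c (p : mode K * mode K) :=
  e p.1 0 (b + 1) * f p.2 0 (b - 1) - e p.1 0 (b - 1) * f p.2 0 (b + 1).
have := @Cintegral_LambdaM _ fst snd c.
rewrite (_ : (fun z => _) = (fun z =>
    cross (trig_field L e (vec z)) (trig_field L f (vec z)) 0 b)); last first.
  apply/funext => z; rewrite mxE !trig_fieldE.
  rewrite !big_distrlr /= !pair_big /= -sumrB; apply: eq_bigr => p _; rewrite /c; ring.
move=> ->.
rewrite -(pair_bigA _ (fun k l => c (k, l) * (if l == oppmode k then (L ^+ 3)%:C else 0))) /=.
rewrite mulr_sumr; apply: eq_bigr => k _.
rewrite (bigD1 (oppmode k))//= eqxx big1 ?addr0 => [|l /negbTE ->]; last by rewrite mulr0.
by rewrite mxE mulrC.
Qed.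

End Modes.

(** * Invariants of the split flows *)

Section CircularIndices.
Implicit Types a : 'I_3.

(** The equations are packed into one tuple so that a single repeated rewrite normalises circular
    indices. *)
Lemma ord3_addC a : ((a + 1 + 1 = a - 1)%R * (a + 1 - 1 = a)%R * (a - 1 + 1 = a)%R *
  (a - 1 - 1 = a + 1)%R)%type.
Proof.
by split; [split; [split|]|]; apply/val_inj; case: a => -[|[|[|//]]].
Qed.

Lemma ord3_cases a (b : 'I_3) : [\/ b = a, b = a + 1 | b = a - 1].
Proof.
by case: a => -[|[|[|//]]] ia; case: b => -[|[|[|//]]] ib;
  by [constructor 1; apply/val_inj|constructor 2; apply/val_inj|constructor 3; apply/val_inj].
Qed.

Lemma sum_ord3 (V : nmodType) (F : 'I_3 -> V) a :
  \sum_b F b = F a + F (a + 1) + F (a - 1).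
Proof.
rewrite !big_ord_recl big_ord0 addr0.
case: a => -[|[|[|//]]] ia; rewrite ?[RHS]addrA.
- by rewrite addrA; congr (F _ + F _ + F _); apply/val_inj.
- rewrite [LHS]addrC; congr (F _ + F _ + F _); exact/val_inj.
- by rewrite addrA [LHS]addrC addrA; congr (F _ + F _ + F _); apply/val_inj.
Qed.

End CircularIndices.

Section Scheme.
Variables (R : realType) (L : R) (K M N : nat).
Variables (q m : 'I_N -> R) (gamma : mode K -> R[i]) (S : 'rV[R]_3 -> R).
Hypothesis L_gt0 : 0 < L.
Hypothesis m_gt0 : forall p, 0 < m p.
Hypothesis gamma_herm : forall k, gamma k = ((gamma (oppmode k))^*)%R.
Hypothesis S_cont : continuous S.
Hypothesis S_periodic : forall a x, S (x + L *: delta_mx 0 a) = S x.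
Implicit Types (s : state R K N) (k : mode K) (a b : 'I_3).

Local Notation ik := (ik L).
Local Notation Pc s p k := (Pi3coef M L gamma (shape_at S (pos s p)) k).

Definition gaussE_coef s := forall k,
  \sum_a ik k 0 a * Ecoef s k 0 a = \sum_(p < N) (q p)%:C * Pc s p k.

Definition gaussB_coef s := forall k, \sum_a ik k 0 a * Bcoef s k 0 a = 0.

Definition momentum_coef s b : R[i] :=
  \sum_(p < N) (m p)%:C * (vel s p 0 b)%:C
  + (L ^+ 3)%:C * \sum_k cross (Ecoef s k) (Bcoef s (oppmode k)) 0 b.

(** Both sides of the law are trigonometric sums, so [Lambda_free] applied to their difference
    passes from functions to coefficients. *)
Lemma gaussEP s : gaussE M L q gamma S s <-> gaussE_coef s.
Proof.
have PE x : Pi3 M L gamma (rho q S s) x =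
    \sum_k (\sum_(p < N) (q p)%:C * Pc s p k) * Lambda L k x.
  by apply: eq_bigr => k _; rewrite Pi3coef_rho.
split=> [gE k|gE x].
  apply/eqP; rewrite -subr_eq0; apply/eqP; move: k.
  apply: (@Lambda_free _ _ L) => // x.
  under eq_bigr do rewrite mulrBl; rewrite sumrB -PE -(gE x).
  by rewrite /EK divergence_trig_field// subrr.
rewrite /EK divergence_trig_field// PE.
by apply: eq_bigr => k _; rewrite gE.
Qed.

Lemma gaussBP s : gaussB L s <-> gaussB_coef s.
Proof.
split=> [gB|gB x].
  by apply: (@Lambda_free _ _ L) => // x; rewrite -divergence_trig_field//; exact: gB.
rewrite /BK divergence_trig_field// big1// => k _.
by rewrite gB mul0r.
Qed.

Lemma momentumE s : momentum L m s = \row_b momentum_coef s b.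
Proof.
rewrite /momentum integral_cube_cross//; apply/rowP => b.
rewrite !mxE !summxE; congr (_ + _); apply: eq_bigr => p _; by rewrite !mxE.
Qed.

(** * Kinetic flow *)

Lemma kinetic_off_axis a tau s s' : kinetic_flow M L q m gamma S a tau s s' ->
  forall b, b != a -> (forall p, pos s' p 0 b = pos s p 0 b) /\
                      (forall k, Ecoef s' k 0 b = Ecoef s k 0 b).
Proof.
move=> [_ H _ _] b ba; have [H1 _ H3] := H 1 (or_introl erefl).
have [H1' _ H3'] := H (-1) (or_intror erefl).
by case: (ord3_cases a b) ba => ->; rewrite ?eqxx.
Qed.

Lemma kinetic_gaussE a tau s s' : kinetic_flow M L q m gamma S a tau s s' ->
  gaussE_coef s -> gaussE_coef s'.
Proof.
move=> fl gE k; have offax := kinetic_off_axis fl.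
have pos_off p b : b != a -> pos s' p 0 b = pos s p 0 b.
  by move=> ba; exact: (offax b ba).1.
have -> : \sum_b ik k 0 b * Ecoef s' k 0 b = \sum_b ik k 0 b * Ecoef s k 0 b +
    ik k 0 a * (Ecoef s' k 0 a - Ecoef s k 0 a).
  apply/eqP; rewrite addrC -subr_eq -sumrB (bigD1 a)//= big1 ?addr0 ?mulrBr// => b ba.
  by rewrite (offax b ba).2 subrr.
case: fl => -[posa _] _ -> _; rewrite gE (addrC (Ecoef s k 0 a)) addrK.
(* If [kval k a = 0], the factor [ik k 0 a] kills the change of the field, and the charge
   coefficient is unchanged because particles move only along [a]. *)
have [k0|k0] := eqVneq (kval k a) 0.
  have -> : ik k 0 a = 0 by apply/eqP; rewrite ik_eq0// k0.
  rewrite mul0r addr0; apply: eq_bigr => p _; congr (_ * _); apply/esym.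
  by apply: (Pi3coef_shape_shift _ _ _ _ _ k0) => // b; exact: pos_off.
have ik0 : ik k 0 a != 0 by rewrite ik_eq0.
(* For [tau = 0] the inverse [tau^-1] is 0 and the cancellation below fails, but the positions do
   not move. *)
have [tau0|tau0] := eqVneq tau 0.
  have posE p : pos s' p = pos s p.
    apply/rowP => b; have [->|/pos_off //] := eqVneq b a.
    by rewrite posa tau0 mul0r addr0.
  rewrite tau0 mul0r oppr0 mulr0 addr0.
  by apply: eq_bigr => p _; rewrite posE.
rewrite mulrN mulrA !mulr_sumr -sumrB; apply: eq_bigr => p _.
rewrite /Vhat3 (negbTE k0).
have tC : tau%:C * (tau^-1)%:C = 1 by rewrite -rmorphM mulfV// rmorph1.
(* Grouping the factors with their inverses leaves the difference of the new and old charge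
   coefficients. *)
set P' := Pc s' p k; set P := Pc s p k.
rewrite (_ : ik k 0 a * tau%:C * _ = - (ik k 0 a * (ik k 0 a)^-1) *
  (tau%:C * (tau^-1)%:C) * ((q p)%:C * (P' - P))); last by ring.
by rewrite mulfV// tC; ring.
Qed.

Lemma kinetic_gaussB a tau s s' : kinetic_flow M L q m gamma S a tau s s' ->
  gaussB_coef s -> gaussB_coef s'.
Proof. by move=> [_ _ _ BE] gB k; rewrite BE. Qed.

(** Each ingredient is Hermitian in [k]: the shape coefficients, and [ik], which is imaginary and
    odd. *)
Lemma Vhat3_conj tau s s' p a k :
  ((Vhat3 M L gamma S tau s s' p a k)^*)%R = Vhat3 M L gamma S tau s s' p a (oppmode k).
Proof.
rewrite /Vhat3 kval_oppmode oppr_eq0; case: eqP => _.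
  by rewrite rmorphM /= conj_real Pi3coef_shape_conj.
rewrite !rmorphM rmorphN rmorphB fmorphV /= conj_real conj_ik ik_oppmode.
by rewrite !Pi3coef_shape_conj.
Qed.

Lemma kinetic_momentum a tau s s' : kinetic_flow M L q m gamma S a tau s s' ->
  momentum_coef s' =1 momentum_coef s.
Proof.
move=> fl b; have offax := kinetic_off_axis fl.
case: fl => -[_ vela] H Ea BE.
have [_ Hv _] := H 1 (or_introl erefl); have [_ Hv' _] := H (-1) (or_intror erefl).
rewrite !mulr1z in Hv; rewrite !mulrN1z opprK in Hv'.
have a1 : a + 1 != a by rewrite -subr_eq0 addrAC subrr add0r.
have a1' : a - 1 != a by rewrite -subr_eq0 addrAC subrr add0r.
have [E1 E2] := (offax _ a1, offax _ a1').
rewrite /momentum_coef.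
(* [J] is the total current that drives the field. In [JE] the masses cancel, [Vhat3_conj] replaces
   the conjugate by a reflected mode, and reindexing moves the reflection onto the magnetic field,
   so that the force on the particles is expressed by the same [J]. *)
pose J k := \sum_(p < N) (q p)%:C * Vhat3 M L gamma S tau s s' p a k.
have JE c : \sum_(p < N) (m p)%:C * ((q p / m p)%:C *
    (\sum_k Bcoef s k 0 c * ((Vhat3 M L gamma S tau s s' p a k)^*)%R)) =
    \sum_k J k * Bcoef s (oppmode k) 0 c.
  under eq_bigr do rewrite mulrA -rmorphM mulrCA divff ?mulr1 ?gt_eqF// mulr_sumr.
  rewrite exchange_big -[RHS]sum_oppmode; apply: eq_bigr => k _.
  rewrite oppmodeK /J mulr_suml; apply: eq_bigr => p _.
  by rewrite Vhat3_conj; ring.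
(* Component [a] of the cross product does not involve the electric field along [a], the only one
   that changes. In the other two components the field gains exactly what the particles lose, with
   opposite signs for [a + 1] and [a - 1]. *)
case: (ord3_cases a b) => ->.
- congr (_ + _ * _); apply: eq_bigr => i _; first by rewrite vela.
  by rewrite !mxE E1.2 E2.2 !BE.
- have -> : \sum_(p < N) (m p)%:C * (vel s' p 0 (a + 1))%:C =
      \sum_(p < N) (m p)%:C * (vel s p 0 (a + 1))%:C -
      tau%:C * (L ^+ 3)%:C * \sum_k J k * Bcoef s (oppmode k) 0 (a - 1).
    rewrite -JE mulr_sumr -sumrB; apply: eq_bigr => p _; rewrite Hv; ring.
  have -> : \sum_k cross (Ecoef s' k) (Bcoef s' (oppmode k)) 0 (a + 1) =
      \sum_k cross (Ecoef s k) (Bcoef s (oppmode k)) 0 (a + 1) +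
      tau%:C * \sum_k J k * Bcoef s (oppmode k) 0 (a - 1).
    rewrite mulr_sumr -big_split; apply: eq_bigr => k _.
    by rewrite /= !mxE !ord3_addC E2.2 !BE Ea -/(J k); ring.
  ring.
- have -> : \sum_(p < N) (m p)%:C * (vel s' p 0 (a - 1))%:C =
      \sum_(p < N) (m p)%:C * (vel s p 0 (a - 1))%:C +
      tau%:C * (L ^+ 3)%:C * \sum_k J k * Bcoef s (oppmode k) 0 (a + 1).
    rewrite -JE mulr_sumr -big_split; apply: eq_bigr => p _; rewrite /= Hv'; ring.
  have -> : \sum_k cross (Ecoef s' k) (Bcoef s' (oppmode k)) 0 (a - 1) =
      \sum_k cross (Ecoef s k) (Bcoef s (oppmode k)) 0 (a - 1) -
      tau%:C * \sum_k J k * Bcoef s (oppmode k) 0 (a + 1).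
    rewrite mulr_sumr -sumrB; apply: eq_bigr => k _.
    by rewrite /= !mxE !ord3_addC E1.2 !BE Ea -/(J k); ring.
  ring.
Qed.

(** * Electromagnetic flow *)

Lemma ik_cross k (v : 'rV[R[i]]_3) : \sum_a ik k 0 a * cross (ik k) v 0 a = 0.
Proof. by rewrite (sum_ord3 _ 0) ![cross _ _ 0 _]mxE !ord3_addC; ring. Qed.

Lemma em_pos (y : R -> state R K N) t u p : em_solution M L q m gamma S y ->
  pos (y t) p = pos (y u) p.
Proof.
move=> ys; apply/rowP => b; apply: (@is_derive_0_is_cst _ (fun t => pos (y t) p 0 b)) => v.
by case: (ys v).
Qed.

(** The charge is constant because positions are frozen. Two arbitrary times are allowed since the
    momentum balance uses the law at every instant of the flow. *)
Lemma em_gaussE (y : R -> state R K N) t u : em_solution M L q m gamma S y ->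
  gaussE_coef (y t) -> gaussE_coef (y u).
Proof.
move=> ys gE k; under [RHS]eq_bigr do rewrite (em_pos u t _ ys); rewrite -gE.
apply: (@is_Cderive_0_is_cst _ (fun t => \sum_a ik k 0 a * Ecoef (y t) k 0 a)) => v.
rewrite -[X in is_Cderive _ _ X](ik_cross k (Bcoef (y v) k)).
apply: (@is_Cderive_sum _ _ _ (fun a t => ik k 0 a * Ecoef (y t) k 0 a)) => a.
by apply: is_CderiveZ; case: (ys v).
Qed.

Lemma em_gaussB (y : R -> state R K N) t u : em_solution M L q m gamma S y ->
  gaussB_coef (y t) -> gaussB_coef (y u).
Proof.
move=> ys gB k; apply: eq_trans (gB k).
apply: (@is_Cderive_0_is_cst _ (fun t => \sum_a ik k 0 a * Bcoef (y t) k 0 a)) => v.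
rewrite -[X in is_Cderive _ _ X]oppr0.
rewrite -[X in is_Cderive _ _ (- X)](ik_cross k (Ecoef (y v) k)) -sumrN.
apply: (@is_Cderive_sum _ _ _ (fun a t => ik k 0 a * Bcoef (y t) k 0 a)) => a.
by rewrite -mulrN; apply: is_CderiveZ; case: (ys v).
Qed.

Lemma is_Cderive_cross (e f : R -> 'rV[R[i]]_3) (e' f' : 'rV[R[i]]_3) t :
  (forall b, is_Cderive (fun u => e u 0 b) t (e' 0 b)) ->
  (forall b, is_Cderive (fun u => f u 0 b) t (f' 0 b)) ->
  forall b, is_Cderive (fun u => cross (e u) (f u) 0 b) t
    (cross e' (f t) 0 b + cross (e t) f' 0 b).
Proof.
move=> de df b; under eq_fun do rewrite mxE.
have := is_CderiveB (is_CderiveM (de (b + 1)) (df (b - 1)))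
  (is_CderiveM (de (b - 1)) (df (b + 1))).
by congr is_Cderive; rewrite !mxE; ring.
Qed.

(** Expanding the dot products cyclically from [b] turns the double cross product formula into a
    polynomial identity. *)
Lemma cross_cross (u v w : 'rV[R[i]]_3) b :
  cross (cross u v) w 0 b = v 0 b * (\sum_c u 0 c * w 0 c) - u 0 b * (\sum_c v 0 c * w 0 c).
Proof. by rewrite !mxE !ord3_addC !(sum_ord3 _ b); ring. Qed.

Lemma cross_crossr (u v w : 'rV[R[i]]_3) b :
  cross u (cross v w) 0 b = v 0 b * (\sum_c u 0 c * w 0 c) - w 0 b * (\sum_c v 0 c * u 0 c).
Proof. by rewrite !mxE !ord3_addC !(sum_ord3 _ b); ring. Qed.

(** Reflecting the modes shows that the sum equals its own opposite. *)
Lemma sum_ik_even (F : mode K -> R[i]) b : (forall k, F (oppmode k) = F k) ->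
  \sum_k ik k 0 b * F k = 0.
Proof.
move=> Fopp; apply/eqP; rewrite -eqNr -sumrN -[X in _ == X]sum_oppmode.
by apply/eqP/eq_bigr => k _; rewrite ik_oppmode Fopp mulNr.
Qed.

Lemma em_momentum (y : R -> state R K N) t u : em_solution M L q m gamma S y ->
  gaussE_coef (y 0) -> gaussB_coef (y 0) ->
  momentum_coef (y t) =1 momentum_coef (y u).
Proof.
move=> ys gE0 gB0 b.
apply: (@is_Cderive_0_is_cst _ (fun t => momentum_coef (y t) b)) => v.
have gE := @em_gaussE y 0 v ys gE0; have gB := @em_gaussB y 0 v ys gB0.
have [_ dV dE dB] := ys v.
(* The transport along [mxE] turns the opposite of an entry into an entry of the opposite row, the
   form [is_Cderive_cross] expects. *)
have dEB k := is_Cderive_cross (dE k) (f' := - cross (ik (oppmode k)) (Ecoef (y v) (oppmode k)))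
  (fun b => eq_ind_r (fun z => is_Cderive _ _ z) (dB (oppmode k) b) (mxE _ _ _ _)) b.
have := is_CderiveD (is_Cderive_sum (index_enum _) (fun p => is_CderiveZ (m p)%:C (dV p b)))
  (is_CderiveZ (L ^+ 3)%:C (is_Cderive_sum (index_enum _) dEB)).
congr is_Cderive.
(* The rate of change of the field momentum is, up to the factor [L ^+ 3], the opposite of the total
   electric force. *)
have -> : \sum_k (cross (cross (ik k) (Bcoef (y v) k)) (Bcoef (y v) (oppmode k)) 0 b +
   cross (Ecoef (y v) k) (- cross (ik (oppmode k)) (Ecoef (y v) (oppmode k))) 0 b) =
   - \sum_k \sum_(p < N) (q p)%:C * (Ecoef (y v) k 0 b * ((Pc (y v) p k)^*)%R).
  transitivity (\sum_k (ik k 0 b * ((\sum_c Ecoef (y v) k 0 c * Ecoef (y v) (oppmode k) 0 c)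
      - (\sum_c Bcoef (y v) k 0 c * Bcoef (y v) (oppmode k) 0 c))
      - Ecoef (y v) (oppmode k) 0 b * \sum_c ik k 0 c * Ecoef (y v) k 0 c)).
    apply: eq_bigr => k _.
    have -> : - cross (ik (oppmode k)) (Ecoef (y v) (oppmode k)) =
        cross (ik k) (Ecoef (y v) (oppmode k)).
      by apply/rowP => c; rewrite [LHS]mxE ![cross _ _ 0 c]mxE !ik_oppmode; ring.
    rewrite cross_cross cross_crossr.
    have -> : \sum_c ik k 0 c * Bcoef (y v) (oppmode k) 0 c = 0.
      rewrite -[RHS]oppr0 -[in RHS](gB (oppmode k)) -sumrN; apply: eq_bigr => c _.
      by rewrite ik_oppmode mulNr opprK.
    by ring.
  rewrite sumrB sum_ik_even ?sub0r => [|k]; last first.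
    by rewrite oppmodeK; congr (_ - _); apply: eq_bigr => c _; rewrite mulrC.
  (* After reflection, the Gauss law at [oppmode k] produces the charge coefficient there, which is
     the conjugate of the one at [k] appearing in the force. *)
  congr (- _); rewrite -sum_oppmode; apply: eq_bigr => k _.
  rewrite oppmodeK gE mulr_sumr; apply: eq_bigr => p _.
  by rewrite Pi3coef_shape_conj//; ring.
rewrite exchange_big mulrN mulr_sumr -sumrB big1// => p _.
rewrite -mulr_sumr !mulrA -rmorphM mulrCA divff ?mulr1 ?gt_eqF//.
by ring.
Qed.

(** Momentum is conserved only under the Gauss laws, which the electromagnetic flow needs; bundling
    their propagation with it makes the relation transitive, hence stable under any composition of
    flows. *)
Definition invariant_step s s' :=
  [/\ gaussE_coef s -> gaussE_coef s', gaussB_coef s -> gaussB_coef s'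
    & gaussE_coef s -> gaussB_coef s -> momentum_coef s' =1 momentum_coef s].

Lemma flow_invariant f tau s s' : flow M L q m gamma S f tau s s' -> invariant_step s s'.
Proof.
case: f => [a|] /= => [fl|[y [ys <- <-]]].
  split; [exact: kinetic_gaussE fl|exact: kinetic_gaussB fl|].
  by move=> _ _; exact: kinetic_momentum fl.
split; [exact: em_gaussE|exact: em_gaussB|exact: em_momentum].
Qed.

Lemma invariant_step_trans s1 s2 s3 :
  invariant_step s1 s2 -> invariant_step s2 s3 -> invariant_step s1 s3.
Proof.
move=> [E1 B1 P1] [E2 B2 P2]; split=> [/E1/E2//|/B1/B2//|gE gB b].
by rewrite P2 ?P1//; [exact: E1|exact: B1].
Qed.

Lemma time_step_invariant w s s' : time_step M L q m gamma S w s s' -> invariant_step s s'.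
Proof.
elim: w s => [s -> //|f w IHw s [s1 [/flow_invariant fl /IHw]]].
exact: invariant_step_trans.
Qed.

End Scheme.

Theorem lemma5 (R : realType) (L : R) (K M N : nat)
    (q m : 'I_N -> R) (gamma : mode K -> R[i]) (S : 'rV[R]_3 -> R)
    (L_gt0 : 0 < L) (KM : (2 * K + 1 <= M)%N) (N_gt0 : (1 <= N)%N)
    (m_gt0 : forall p, 0 < m p)
    (gamma_herm : forall k, gamma k = (gamma (oppmode k))^*)
    (S_cont : continuous S)
    (S_periodic : forall a x, S (x + L *: delta_mx 0 a) = S x)
    (w : nat -> seq (split_flow * R)) (s : nat -> state R K N)
    (E_real : real_valued (EK L (s 0%N))) (B_real : real_valued (BK L (s 0%N)))
    (scheme : forall n, time_step M L q m gamma S (w n) (s n) (s n.+1)) :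
  [/\ forall n x, Pi3 M L gamma (rho q S (s n)) x =
        \sum_(p < N) (q p)%:C * Pi3 M L gamma (shape_at S (pos (s n) p)) x,
      gaussE M L q gamma S (s 0%N) -> forall n, gaussE M L q gamma S (s n),
      gaussB L (s 0%N) -> forall n, gaussB L (s n)
    & gaussE M L q gamma S (s 0%N) -> gaussB L (s 0%N) ->
      forall n, momentum L m (s n) = momentum L m (s 0%N)].
Proof.
have inv n : invariant_step L M q m gamma S (s n) (s n.+1).
  exact: (time_step_invariant L_gt0 m_gt0 gamma_herm S_cont S_periodic (scheme n)).
have inv0 n : invariant_step L M q m gamma S (s 0%N) (s n).
  by elim: n => [|n IHn]; [split|exact: invariant_step_trans IHn (inv n)].
have gEP s1 := @gaussEP R L K M N q gamma S L_gt0 S_cont s1.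
have gBP s1 := @gaussBP R L K N L_gt0 s1.
split=> [n x|/gEP gE n|/gBP gB n|/gEP gE /gBP gB n].
- exact: Pi3_rho.
- by apply/gEP; case: (inv0 n) => H _ _; exact: H.
- by apply/gBP; case: (inv0 n) => _ H _; exact: H.
- rewrite !momentumE//; apply/rowP => b; rewrite !mxE.
  by case: (inv0 n) => _ _ H; exact: H.
Qed.
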